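(* Let $n\ge1$ be an integer and let $c\colon2^{[n]}\to[0,\infty)$ be a function on subsets of $[n]$. Let $\mathcal{X}=\mathfrak{S}_n$ be the symmetric group on $[n]$, let $\pi$ be the uniform law on $\mathcal{X}$, and let $L$ be the generator acting on $f\colon\mathcal{X}\to\mathbb{R}$ by $$Lf(x)=\sum_{A\subseteq[n]}\frac{c(A)}{|A|!}\sum_{\sigma\in\mathfrak{S}_A}\left(f(x\sigma)-f(x)\right).$$ Then for any $\mu\in\mathcal{P}(\mathcal{X})$ and $t\ge0$, the matrix $P_t:=e^{tL}$ satisfies $$H(\mu P_t\,|\,\pi)\le H(\mu\,|\,\pi)\max_{1\le i,j\le n}\mathbb{P}_{i,j}(T>t),$$ where $T:=\min\{t\ge0\colon I_t=J_t\}$ denotes the meeting time of two independent continuous-time random walks $I,J$ on $[n]$ with conductances $$\widehat{c}(k,l):=\sum_{A\supseteq\{k,l\}}\frac{c(A)}{|A|}\qquad(k\neq l),$$ starting from $I_0=i$ and $J_0=j$, respectively.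
   Context: $[n]=\{1,\ldots,n\}$. $\mathfrak{S}_A$ denotes the group of permutations of $A$, viewed as the permutations of $[n]$ fixing every point outside $A$; $|A|$ is the cardinality of $A$. A permutation $x$ assigns label $x_i=x(i)$ to site $i$, and $x\sigma$ is the composition $i\mapsto x(\sigma(i))$. A random walk with conductances $\widehat{c}$ jumps from $k$ to $l\neq k$ at rate $\widehat{c}(k,l)$. $T=\infty$ if the walks never meet. $\mathcal{P}(\mathcal{X})$ is the set of probability measures on $\mathcal{X}$, and $H(\mu\,|\,\pi):=\sum_x\mu(x)\log(\mu(x)/\pi(x))$ is the relative entropy (with $0\log0=0$). *)

(* Defs.v *)
From HB Require Import structures.
From mathcomp Require Import all_boot all_order all_algebra all_fingroup.
From mathcomp Require Import all_classical all_reals all_analysis.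
Set Implicit Arguments.
Unset Strict Implicit.
Unset Printing Implicit Defensive.
Import Order.TTheory GRing.Theory Num.Theory.
Import numFieldNormedType.Exports.
Local Open Scope classical_set_scope.
Local Open Scope ring_scope.

(* Laws, matrices and generators on a finite state space. *)
Section FiniteState.
Context {R : realType} {X : finType}.

Definition is_law (mu : X -> R) : Prop :=
  (forall x, 0 <= mu x) /\ \sum_x mu x = 1.

Definition uniform_law (x : X) : R := #|X|%:R^-1.

(* Since [ln 0 = 0] here, the convention 0 log 0 = 0 is automatic. The formula
   is the relative entropy only when [mu] vanishes wherever [pi] does, e.g.
   when [pi] is positive everywhere, as the uniform law is. *)
Definition rel_entropy (mu pi : X -> R) : R :=
  \sum_x mu x * ln (mu x / pi x).

(* [exp_gen L t f x] is (e^{tL} f)(x) = \sum_k t^k / k! (L^k f)(x); the series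
   converges for every linear [L] since [X] is finite. *)
Definition exp_gen (L : (X -> R) -> X -> R) (t : R) (f : X -> R) (x : X) : R :=
  limn (series (fun k : nat => t ^+ k / (k`!)%:R * iter k L f x)).

(* The entry at (x, y) of the matrix e^{tL}, the image of the indicator of y. *)
Definition exp_mx (L : (X -> R) -> X -> R) (t : R) (x y : X) : R :=
  exp_gen L t (fun z => (z == y)%:R) x.

Definition law_mul (mu : X -> R) (K : X -> X -> R) (y : X) : R :=
  \sum_x mu x * K x y.

Definition walk_generator (chat : X -> X -> R) (f : X -> R) (k : X) : R :=
  \sum_(l | l != k) chat k l * (f l - f k).

End FiniteState.

(* Sites 1, ..., n are represented by 'I_n. *)
Section Shuffle.
Context {R : realType} {n : nat}.
Implicit Type c : {set 'I_n} -> R.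

(* MathComp composes permutations from left to right, so [(s * x)%g] is the map
   i |-> x (s i), which is written x s in the usual notation. The predicate
   [perm_on A s] says that s fixes every point outside A. *)
Definition shuffle_generator c (f : 'S_n -> R) (x : 'S_n) : R :=
  \sum_(A : {set 'I_n})
    c A / (#|A| `!)%:R * \sum_(s : 'S_n | perm_on A s) (f (s * x)%g - f x).

(* Only the values at k != l matter. *)
Definition conductance c (k l : 'I_n) : R :=
  \sum_(A : {set 'I_n} | [set k; l]%SET \subset A) c A / #|A|%:R.

End Shuffle.

(* Processes with values in a finite set, indexed by the times t >= 0; values
   at negative times are irrelevant. *)
Section Processes.
Context {R : realType} {X : finType} {d : measure_display}
  {Omega : measurableType d}.
Implicit Types (P : probability Omega R) (I J : R -> Omega -> X).

(* The sigma-algebra generated by the variables I_s, s \in D. *)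
Definition sigma_process I (D : set R) : set (set Omega) :=
  <<s [set E | exists2 s, D s & exists k, E = I s @^-1` [set k]] >>.

(* Under P, I is a right-continuous continuous-time Markov chain that starts
   from i and jumps from k to l at rate chat k l. *)
Record random_walk P (chat : X -> X -> R) (i : X) I : Prop := RandomWalk {
  rw_measurable : forall (t : R) k, 0 <= t -> measurable (I t @^-1` [set k]) ;
  rw_right_continuous : forall w (t : R), 0 <= t ->
    \forall s \near t^'+, I s w = I t w ;
  rw_start : P (I 0 @^-1` [set i]) = 1%E ;
  rw_markov : forall (s t : R) k l E, 0 <= s -> 0 <= t ->
    sigma_process I [set u | 0 <= u <= s] E ->
    P (E `&` I s @^-1` [set k] `&` I (s + t) @^-1` [set l]) =
    (P (E `&` I s @^-1` [set k])
      * (exp_mx (walk_generator chat) t k l)%:E)%E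
}.

Definition independent_processes P I J : Prop :=
  forall E F, sigma_process I [set u | 0 <= u] E ->
    sigma_process J [set u | 0 <= u] F -> P (E `&` F) = (P E * P F)%E.

(* The infimum of the empty set is +oo. Otherwise the infimum is a minimum as
   soon as I and J are right-continuous. *)
Definition meeting_time I J (w : Omega) : \bar R :=
  ereal_inf [set s%:E | s in [set s | 0 <= s /\ I s w = J s w]].

End Processes.

(* Main.v *)
(* Run the semigroup Q_s of random transpositions next to P_t = e^{tL}. It
   commutes with P_t and drives every law to the uniform one, so entropies are
   integrals over s of the entropy production of Q, a sum over pairs (i, j) of
     F f (i, j) = sum_x (f x - f (x (i j))) (ln (f x) - ln (f (x (i j)))),
   and it suffices to contract F under P_t. As (a, b) |-> (a - b)(ln a - ln b)
   is convex and 1-homogeneous, shuffling a block A with f replaces F f (i, j) by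
   at most its average over the shuffled positions of i and j, and by 0 when i
   and j are both in A. Hence F (P_t f) <= e^{tG} (F f), where G is the
   symmetric generator of two tokens i and j that share the shuffles and die
   when they lie in the same block, and sum F (P_t f) is at most sum F f times
   the largest survival probability w_t of the two tokens.

   It remains to compare w_t with the survival of two independent walks. Each
   shuffle preserves pseudometrics, so w_t satisfies the triangle inequality;
   averaging w_t (i, j) <= w_t (i, k) + w_t (k, j) over k in A shows that killing
   the pair is at least as harmful to w_t as moving both tokens independently
   inside A. So w_t is at most the probability that the independent walks are
   apart on any finite grid of times, and right-continuity gives P(T > t). *)
Require Import Defs.
From HB Require Import structures.
From mathcomp Require Import all_boot all_order all_algebra all_fingroup.
From mathcomp Require Import all_classical all_reals all_analysis.
From mathcomp Require Import ring lra.
Set Implicit Arguments.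
Unset Strict Implicit.
Unset Printing Implicit Defensive.
Import Order.TTheory GRing.Theory Num.Theory.
Import numFieldNormedType.Exports.
Local Open Scope classical_set_scope.
Local Open Scope ring_scope.

(** * Linear operators on a finite state space *)

Section RealCalculus.
Context {R : realType}.
Implicit Types (f g : R -> R) (x df dg : R).

Lemma is_derive1D f g x df dg : is_derive x 1 f df -> is_derive x 1 g dg ->
  is_derive x 1 (fun t => f t + g t) (df + dg).
Proof. by move=> ? ?; exact: is_deriveD. Qed.

Lemma is_derive1M f g x df dg : is_derive x 1 f df -> is_derive x 1 g dg ->
  is_derive x 1 (fun t => f t * g t) (df * g x + f x * dg).
Proof.
move=> hf hg; have := is_deriveM hf hg.
by rewrite /GRing.scale /= addrC [g x * df]mulrC.
Qed.

Lemma is_derive1_sum (I : Type) (r : seq I) (P : pred I) (h : I -> R -> R) x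
    (dh : I -> R) :
  (forall i, P i -> is_derive x 1 (h i) (dh i)) ->
  is_derive x 1 (fun t => \sum_(i <- r | P i) h i t) (\sum_(i <- r | P i) dh i).
Proof.
move=> hh; elim: r => [|i r IH].
  rewrite big_nil (_ : (fun _ => _) = cst 0); first exact: is_derive_cst.
  by apply/funext => t; rewrite big_nil.
under [X in is_derive _ _ X _]funext do rewrite big_cons.
rewrite big_cons; case: ifP => // Pi.
by apply: is_derive1D => //; exact: hh.
Qed.

Lemma is_derive1Zl a f x df : is_derive x 1 f df ->
  is_derive x 1 (fun t => a * f t) (a * df).
Proof. by move=> hf; exact: is_deriveZ. Qed.

Lemma is_derive1_affine a b f x df : is_derive (a + b * x) 1 f df ->
  is_derive x 1 (fun t => f (a + b * t)) (df * b).
Proof.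
move=> hf; apply: (@is_derive1_comp _ f (fun t => a + b * t) x df b).
have ha : is_derive x 1 (fun _ : R => a) 0 by exact: is_derive_cst.
by have := is_derive1D ha (is_derive1Zl b (is_derive_id x 1)); rewrite add0r mulr1.
Qed.

Lemma is_derive1_le0 f (df : R -> R) (a : R) :
  (forall x, a <= x -> is_derive x 1 f (df x)) -> (forall x, a <= x -> df x <= 0) ->
  forall x, a <= x -> f x <= f a.
Proof.
move=> hf hle x ax; apply: (@ler0_derive1_nincry _ f a) => //.
- by move=> y; rewrite in_itv/= andbT => /ltW ay; have [] := hf y ay.
- move=> y; rewrite in_itv/= andbT => /ltW ay; rewrite derive1E.
  by have hy := hf y ay; rewrite derive_val; exact: hle.
- apply: continuous_in_subspaceT => y; rewrite inE/= in_itv/= andbT => ay.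
  by have [dy _] := hf y ay; exact/differentiable_continuous/derivable1_diffP.
Qed.

End RealCalculus.

(** * Operators given by a kernel *)

Section LinearOperators.
Context {R : realType}.

(** [Y] may be infinite: the outputs of [energy_tangent] are indexed by all choices of slopes. *)
Definition lin_op (X : finType) (Y : Type) (L : (X -> R) -> Y -> R) : Prop :=
  exists l : Y -> X -> R, forall f y, L f y = \sum_x l y x * f x.

Lemma lin_op_eval (X : finType) Y (p : Y -> X) : lin_op (fun f y => f (p y)).
Proof.
exists (fun y x => (x == p y)%:R) => f y.
rewrite (bigD1 (p y)) //= eqxx mul1r big1 ?addr0 // => x /negbTE ->.
by rewrite mul0r.
Qed.

Lemma lin_opZ (X : finType) Y (a : Y -> R) (L : (X -> R) -> Y -> R) :
  lin_op L -> lin_op (fun f y => a y * L f y).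
Proof.
case=> l hl; exists (fun y x => a y * l y x) => f y.
by rewrite hl mulr_sumr; apply: eq_bigr => x _; rewrite mulrA.
Qed.

Lemma lin_opD (X : finType) Y (L M : (X -> R) -> Y -> R) :
  lin_op L -> lin_op M -> lin_op (fun f y => L f y + M f y).
Proof.
case=> l hl [m hm]; exists (fun y x => l y x + m y x) => f y.
by rewrite hl hm -big_split; apply: eq_bigr => x _; rewrite mulrDl.
Qed.

Lemma lin_opB (X : finType) Y (L M : (X -> R) -> Y -> R) :
  lin_op L -> lin_op M -> lin_op (fun f y => L f y - M f y).
Proof.
case=> l hl [m hm]; exists (fun y x => l y x - m y x) => f y.
by rewrite hl hm -sumrB; apply: eq_bigr => x _; rewrite mulrBl.
Qed.

(** The filter may depend on the output point, as in [walk_generator], whose sum skips the current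
    site. *)
Lemma lin_op_sum (X : finType) Y (I : Type) (r : seq I) (P : I -> Y -> bool)
    (L : I -> (X -> R) -> Y -> R) :
  (forall i, lin_op (L i)) -> lin_op (fun f y => \sum_(i <- r | P i y) L i f y).
Proof.
move=> hL; elim: r => [|i r [l hl]].
  by exists (fun _ _ => 0) => f y; rewrite big_nil big1 // => x _; rewrite mul0r.
have [m hm] := hL i.
exists (fun y x => if P i y then m y x + l y x else l y x) => f y.
rewrite big_cons hl hm; case: ifP => // _.
by rewrite -big_split; apply: eq_bigr => x _; rewrite mulrDl.
Qed.

Lemma lin_op_linear (X : finType) Y (L : (X -> R) -> Y -> R) a f g y :
  lin_op L -> L (fun x => a * f x + g x) y = a * L f y + L g y.
Proof.
case=> l hl; rewrite !hl mulr_sumr -big_split.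
by apply: eq_bigr => x _ /=; rewrite mulrDr mulrCA.
Qed.

Lemma lin_op_lin_sum (X : finType) Y (L : (X -> R) -> Y -> R) (I : Type)
    (r : seq I) (P : pred I) (a : I -> R) (f : I -> X -> R) y : lin_op L ->
  L (fun x => \sum_(i <- r | P i) a i * f i x) y =
  \sum_(i <- r | P i) a i * L (f i) y.
Proof.
case=> l hl; rewrite hl.
under [RHS]eq_bigr do rewrite hl mulr_sumr.
rewrite exchange_big /=; apply: eq_bigr => x _.
by rewrite mulr_sumr; apply: eq_bigr => i _; rewrite mulrCA.
Qed.

Lemma lin_op_cvg (X : finType) Y (L : (X -> R) -> Y -> R) (u : nat -> X -> R)
    (f : X -> R) y : lin_op L -> (forall x, u k x @[k --> \oo] --> f x) ->
  L (u k) y @[k --> \oo] --> L f y.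
Proof.
case=> l hl hu; rewrite hl.
under [X in X @ _ --> _]funext do rewrite hl.
by apply: cvg_big => [|x _]; [exact: add_continuous | exact: cvgMl_tmp].
Qed.

End LinearOperators.

(** * Exponentials *)

Section Exponential.
Context {R : realType}.

(** The sum of the absolute values of all matrix entries bounds the norm of [L] on l^1. *)
Lemma lin_op_iter_bound (X : finType) (L : (X -> R) -> X -> R) : lin_op L ->
  exists2 b : R, 0 <= b &
    forall f k x, `|iter k L f x| <= b ^+ k * \sum_y `|f y|.
Proof.
case=> l hl; pose b := \sum_y \sum_x `|l y x|.
have b0 : 0 <= b by apply: sumr_ge0 => y _; exact: sumr_ge0.
exists b => // f k x.
suff h : \sum_y `|iter k L f y| <= b ^+ k * \sum_y `|f y|.
  apply: le_trans h; rewrite (bigD1 x) //= lerDl; exact: sumr_ge0.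
elim: k => [|k IH] /=; first by rewrite mul1r.
rewrite exprS -mulrA; apply: le_trans (ler_wpM2l b0 IH).
rewrite /b mulr_suml; apply: ler_sum => y _.
rewrite hl (le_trans (ler_norm_sum _ _ _)) // mulr_suml.
apply: ler_sum => z _; rewrite normrM ler_wpM2l //.
by rewrite (bigD1 z) //= lerDl; exact: sumr_ge0.
Qed.

Section OneOperator.
Context {X : finType} (L : (X -> R) -> X -> R).
Hypothesis hL : lin_op L.
Implicit Types (f g : X -> R) (t s : R).

Lemma lin_op_iter k : lin_op (iter k L).
Proof.
elim: k => [|k [m hm]]; first exact: (lin_op_eval (fun x : X => x)).
have [l hl] := hL; exists (fun y x => \sum_z l y z * m z x) => f y.
transitivity (\sum_x l y x * \sum_z m x z * f z).
  by apply: etrans (hl (iter k L f) y) _; apply: eq_bigr => x _; congr (_ * _); exact: hm.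
under eq_bigr do rewrite mulr_sumr.
rewrite exchange_big /=; apply: eq_bigr => x _.
by rewrite mulr_suml; apply: eq_bigr => z _; rewrite mulrA.
Qed.

Let coef f x := fun k : nat => iter k L f x / k`!%:R.

Let seriesE f x t :
  series (fun k : nat => t ^+ k / k`!%:R * iter k L f x) = pseries (coef f x) t.
Proof.
by apply/funext => n; apply: eq_bigr => k _; rewrite mulrC mulrA mulrAC.
Qed.

(** Since (k+1) / (k+1)! = 1 / k!, differentiating the series of e^{tL} f term by term gives that of
    e^{tL} (L f). *)
Let diffs_coef f x : pseries_diffs (coef f x) = coef (L f) x.
Proof.
apply/funext => k; rewrite /pseries_diffs /coef factS natrM invfM mulrCA.
by rewrite mulVKf ?pnatr_eq0 //; congr (_ * _); exact: (congr1 (@^~ x) (iterSr k L f)).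
Qed.

Let is_cvg_coef f x t : cvgn (pseries (coef f x) t).
Proof.
have [b b0 hb] := lin_op_iter_bound hL; pose m : R := \sum_y `|f y|.
have m0 : 0 <= m by exact: sumr_ge0.
apply: normed_cvg; rewrite /normed_series_of /=.
(* Domination by [m] times the series of exp (b |t|). *)
apply: (@series_le_cvg _ _ (fun k => m * exp_coeff (b * `|t|) k)) => //.
- by move=> k; rewrite mulr_ge0 // exp_coeff_ge0 // mulr_ge0.
- move=> k; rewrite /exp_coeff /= /coef !normrM normfV normrX exprMn.
  rewrite (@ger0_norm _ k`!%:R) ?ler0n // mulrAC [leRHS]mulrA.
  rewrite ler_wpM2r ?invr_ge0 ?ler0n // mulrA ler_wpM2r ?exprn_ge0 // mulrC.
  exact: hb.
- have := is_cvg_series_exp_coeff (b * `|t|).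
  by move=> /(@is_cvg_seriesZ R _ m); exact.
Qed.

Lemma cvg_exp_gen f x t :
  series (fun k : nat => t ^+ k / k`!%:R * iter k L f x) n @[n --> \oo]
    --> exp_gen L t f x.
Proof. by rewrite /exp_gen seriesE; exact: is_cvg_coef. Qed.

Lemma exp_gen_unique f x t l :
  series (fun k : nat => t ^+ k / k`!%:R * iter k L f x) n @[n --> \oo] --> l ->
  exp_gen L t f x = l.
Proof. by move=> /cvg_lim; exact. Qed.

Lemma is_derive_exp_gen f x t :
  is_derive t 1 (fun s => exp_gen L s f x) (exp_gen L t (L f) x).
Proof.
have E g s : exp_gen L s g x = limn (pseries (coef g x) s).
  by rewrite /exp_gen seriesE.
rewrite (_ : (fun s => _) = fun s => limn (pseries (coef f x) s)); last first.
  by apply/funext => s; exact: E.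
rewrite E -diffs_coef.
(* Any point beyond [|t|] shows that [t] lies inside the disc of convergence. *)
apply: (@pseries_snd_diffs _ _ (`|t| + 1)); rewrite ?diffs_coef //.
by rewrite [ltRHS]ger0_norm ?addr_ge0 // ltrDl.
Qed.

Lemma exp_gen0 f x : exp_gen L 0 f x = f x.
Proof.
apply: exp_gen_unique; rewrite -cvg_shiftS; apply: cvg_near_cst.
apply: nearW => n; rewrite /series /= big_nat_recl //= expr0 fact0 divr1 mul1r.
by rewrite big1 ?addr0 // => k _; rewrite expr0n /= mul0r mul0r.
Qed.

Lemma lin_op_exp_gen t : lin_op (exp_gen L t).
Proof.
exists (fun x y => exp_mx L t x y) => f x; apply: exp_gen_unique.
have h k : iter k L f x = \sum_y f y * iter k L (fun z => (z == y)%:R) x.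
  apply: etrans (lin_op_lin_sum (index_enum X) predT f _ x (lin_op_iter k)).
  congr (iter k L _ x); apply/funext => z.
  rewrite (bigD1 z) //= eqxx mulr1 big1 ?addr0 // => y /negbTE.
  by rewrite eq_sym => ->; rewrite mulr0.
under [X in X @ _ --> _]funext => n.
  rewrite /series /=; under eq_bigr do rewrite h mulr_sumr.
  rewrite exchange_big /=.
  under eq_bigr => y _.
    under eq_bigr do rewrite mulrCA.
    rewrite -mulr_sumr mulrC; over.
  over.
apply: cvg_big => [|y _]; first exact: add_continuous.
by apply: cvgMr_tmp; exact: cvg_exp_gen.
Qed.

Lemma exp_genE t f x : exp_gen L t f x = \sum_y exp_mx L t x y * f y.
Proof.
have [l hl] := lin_op_exp_gen t; rewrite hl; apply: eq_bigr => y _.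
rewrite /exp_mx hl (bigD1 y) //= eqxx mulr1 big1 ?addr0 // => z /negbTE ->.
by rewrite mulr0.
Qed.

Lemma is_derive_exp_mx t x y : is_derive t 1 (fun s => exp_mx L s x y)
  (exp_gen L t (L (fun z => (z == y)%:R)) x).
Proof. exact: is_derive_exp_gen. Qed.

Lemma exp_gen_generator t f x :
  exp_gen L t (L f) x = L (exp_gen L t f) x.
Proof.
apply: exp_gen_unique.
have -> : series (fun k : nat => t ^+ k / k`!%:R * iter k L (L f) x) =
    fun n => L (fun y => \sum_(0 <= k < n) t ^+ k / k`!%:R * iter k L f y) x.
  apply/funext => n; rewrite lin_op_lin_sum //; apply: eq_bigr => k _.
  by rewrite -iterSr.
apply: lin_op_cvg => // y; exact: cvg_exp_gen.
Qed.

End OneOperator.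

Lemma exp_gen_commute (X : finType) (L M : (X -> R) -> X -> R) t f x :
  lin_op L -> lin_op M -> (forall g y, L (M g) y = M (L g) y) ->
  exp_gen L t (M f) x = M (exp_gen L t f) x.
Proof.
move=> hL hM LM; apply: exp_gen_unique.
have LMk k : iter k L (M f) = M (iter k L f).
  by elim: k => //= k ->; apply/funext => y; rewrite LM.
have -> : series (fun k : nat => t ^+ k / k`!%:R * iter k L (M f) x) =
    fun n => M (fun y => \sum_(0 <= k < n) t ^+ k / k`!%:R * iter k L f y) x.
  by apply/funext => n; rewrite lin_op_lin_sum //; apply: eq_bigr => k _; rewrite LMk.
by apply: lin_op_cvg => // y; exact: cvg_exp_gen.
Qed.

Lemma exp_gen_commute2 (X : finType) (L M : (X -> R) -> X -> R) t s f x :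
  lin_op L -> lin_op M -> (forall g y, L (M g) y = M (L g) y) ->
  exp_gen L t (exp_gen M s f) x = exp_gen M s (exp_gen L t f) x.
Proof.
move=> hL hM LM; apply: exp_gen_commute => //; first exact: lin_op_exp_gen.
by move=> g y; rewrite -exp_gen_commute.
Qed.

Lemma exp_gen_adjoint (X : finType) (L : (X -> R) -> X -> R) t f g : lin_op L ->
  (forall f g, \sum_x g x * L f x = \sum_x L g x * f x) ->
  \sum_x g x * exp_gen L t f x = \sum_x exp_gen L t g x * f x.
Proof.
move=> hL sym.
have symk k : \sum_x g x * iter k L f x = \sum_x iter k L g x * f x.
  elim: k f => //= k IH h; rewrite -iterS iterSr IH.
  by rewrite -sym.
have h1 (u v : X -> R) : (fun n => \sum_x v x *
    series (fun k : nat => t ^+ k / k`!%:R * iter k L u x) n) n @[n --> \oo] -->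
    \sum_x v x * exp_gen L t u x.
  apply: cvg_big => [|x _]; first exact: add_continuous.
  by apply: cvgMl_tmp; exact: cvg_exp_gen.
under [RHS]eq_bigr do rewrite mulrC.
rewrite -(cvg_lim _ (h1 f g)) // -(cvg_lim _ (h1 g f)) //.
congr (limn _); apply/funext => n; rewrite /series /=.
under eq_bigr do rewrite mulr_sumr.
under [RHS]eq_bigr do rewrite mulr_sumr.
rewrite exchange_big [RHS]exchange_big; apply: eq_bigr => k _ /=.
under eq_bigr do rewrite mulrCA.
under [RHS]eq_bigr do rewrite mulrCA.
by rewrite -!mulr_sumr symk; congr (_ * _); apply: eq_bigr => x _; rewrite mulrC.
Qed.

(** Uniqueness for y' = L y: the function s |-> e^{(t-s)L} y_s has zero derivative, and its values
    at 0 and [t] are the two sides. *)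
Lemma exp_gen_ode (X : finType) (L : (X -> R) -> X -> R) (y : R -> X -> R)
    (t : R) (x : X) :
  lin_op L -> (forall (s : R) (z : X), is_derive s 1 (fun r => y r z) (L (y s) z)) ->
  y t x = exp_gen L t (y 0) x.
Proof.
move=> hL hy.
pose z s := exp_gen L (t - s) (y s) x.
suff : z t = z 0 by rewrite /z subrr subr0 exp_gen0.
apply: is_derive_0_is_cst => s.
have -> : z = fun s => \sum_w exp_mx L (t + (-1) * s) x w * y s w.
  by apply/funext => r; rewrite /z exp_genE // mulN1r.
have hd w : is_derive s 1 (fun s => exp_mx L (t + (-1) * s) x w * y s w)
   (exp_gen L (t - s) (L (fun v => (v == w)%:R)) x * (-1) * y s w
    + exp_mx L (t - s) x w * L (y s) w).
  have := is_derive1M (is_derive1_affine (is_derive_exp_mx hL (t + (-1) * s) x w))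
    (hy s w).
  by rewrite mulN1r.
have := is_derive1_sum (index_enum X) (P := xpredT) (fun w _ => hd w).
suff -> : \sum_w (exp_gen L (t - s) (L (fun v => (v == w)%:R)) x * (-1) * y s w
    + exp_mx L (t - s) x w * L (y s) w) = 0 by [].
rewrite big_split /= -exp_genE // exp_gen_generator //.
have -> : exp_gen L (t - s) (y s) =
    fun v => \sum_w y s w * exp_gen L (t - s) (fun u => (u == w)%:R) v.
  by apply/funext => v; rewrite exp_genE //; apply: eq_bigr => w _; rewrite mulrC.
rewrite lin_op_lin_sum // -big_split big1 // => w _ /=.
rewrite exp_gen_generator //; ring.
Qed.

Lemma exp_genD (X : finType) (L : (X -> R) -> X -> R) s t f x : lin_op L ->
  exp_gen L (s + t) f x = exp_gen L t (exp_gen L s f) x.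
Proof.
move=> hL.
have hd (r : R) z : is_derive r 1 (fun u => exp_gen L (s + u) f z)
    (L (exp_gen L (s + r) f) z).
  rewrite -exp_gen_generator //.
  have := is_derive1_affine (x := r) (a := s) (b := 1)
    (is_derive_exp_gen hL f z (s + 1 * r)).
  by rewrite mulr1; under [X in is_derive _ _ X]funext do rewrite mul1r; rewrite mul1r.
by apply: etrans (exp_gen_ode t x hL hd) _; rewrite addr0.
Qed.

(** The right-hand side solves y' = (L + a) y with initial value [f], so uniqueness applies. *)
Lemma exp_gen_shift (X : finType) (L : (X -> R) -> X -> R) a t f x : lin_op L ->
  exp_gen (fun g y => L g y + a * g y) t f x = expR (a * t) * exp_gen L t f x.
Proof.
move=> hL; set M := fun g y => _.
have hM : lin_op M.
  by apply: lin_opD => //; apply: lin_opZ; exact: (lin_op_eval (fun y : X => y)).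
have hd (s : R) z : is_derive s 1 (fun r => expR (a * r) * exp_gen L r f z)
    (M (fun w => expR (a * s) * exp_gen L s f w) z).
  have hE : is_derive s 1 (fun r => expR (a * r)) (expR (a * s) * a).
    have := is_derive1_affine (x := s) (a := 0) (b := a) (is_derive_expR (0 + a * s)).
    by under [X in is_derive _ _ X]funext do rewrite add0r; rewrite add0r.
  have := is_derive1M hE (is_derive_exp_gen hL f z s).
  suff -> : M (fun w => expR (a * s) * exp_gen L s f w) z =
    expR (a * s) * a * exp_gen L s f z + expR (a * s) * exp_gen L s (L f) z by [].
  have [l hl] := hL; rewrite /M exp_gen_generator //.
  rewrite [X in X + _]hl [X in _ = _ + _ * X]hl mulr_sumr.
  rewrite addrC mulrCA mulrA; congr (_ + _).
  by apply: eq_bigr => w _; rewrite mulrCA.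
apply: etrans (esym (exp_gen_ode t x hM hd)).
congr (exp_gen M t _ x); apply/funext => z.
by rewrite mulr0 expR0 mul1r exp_gen0.
Qed.

End Exponential.

(** * Closed convex cones preserved by exponentials *)

Section Cones.
Context {R : realType}.

(** A cone of pairs, read as a relation, lets two semigroups on different spaces evolve side by side
    under joint linear constraints. *)
Record closed_cone (X Y : finType) (K : (X -> R) -> (Y -> R) -> Prop) : Prop :=
  ClosedCone {
  cone0 : K (fun=> 0) (fun=> 0) ;
  coneD : forall b f g f' g', 0 <= b -> K f g -> K f' g' ->
    K (fun x => b * f x + f' x) (fun y => b * g y + g' y) ;
  cone_lim : forall (u : nat -> X -> R) (v : nat -> Y -> R) f g,
    (forall k, K (u k) (v k)) -> (forall x, u k x @[k --> \oo] --> f x) ->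
    (forall y, v k y @[k --> \oo] --> g y) -> K f g }.

Lemma closed_cone_and (X Y : finType) (K K' : (X -> R) -> (Y -> R) -> Prop) :
  closed_cone K -> closed_cone K' -> closed_cone (fun f g => K f g /\ K' f g).
Proof.
case=> h0 hD hl [h0' hD' hl']; split => //.
- by move=> b f g f' g' b0 [? ?] [? ?]; split; [exact: hD | exact: hD'].
- move=> u v f g huv hu hv; split.
    by apply: (hl u v) => // k; have [] := huv k.
  by apply: (hl' u v) => // k; have [] := huv k.
Qed.

Lemma closed_cone_le (X Y : finType) (I : Type)
    (p : (X -> R) -> I -> R) (q : (Y -> R) -> I -> R) :
  lin_op p -> lin_op q -> closed_cone (fun f g => forall i, p f i <= q g i).
Proof.
move=> hp hq; split.
- move=> i; case: hp hq => [p' hp] [q' hq]; rewrite hp hq.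
  by rewrite !big1 // => ? _; rewrite mulr0.
- move=> b f g f' g' b0 h h' i; rewrite !lin_op_linear //.
  by rewrite lerD // ler_wpM2l.
- move=> u v f g huv hu hv i.
  have hpu := @lin_op_cvg _ _ _ _ u f i hp hu.
  have hqv := @lin_op_cvg _ _ _ _ v g i hq hv.
  apply: ler_cvg_to hpu hqv _; exact: nearW.
Qed.

Lemma closed_cone_ge0 (X Y : finType) :
  closed_cone (fun (f : X -> R) (_ : Y -> R) => forall x, 0 <= f x).
Proof.
split => // [b f _ f' _ b0 f0 f0' x|u _ f _ u0 hu _ x].
  by rewrite addr_ge0 // mulr_ge0.
by apply: ler_cvg_to (cvg_cst (0 : R)) (hu x) _; apply: nearW => k; exact: u0.
Qed.

(* [e^{tL} = e^{-at} e^{t(L + a)}] and the last exponential is a series with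
   nonnegative coefficients. *)
Lemma exp_gen_cone (X Y : finType) (K : (X -> R) -> (Y -> R) -> Prop)
    (L : (X -> R) -> X -> R) (M : (Y -> R) -> Y -> R) (a t : R) f g :
  closed_cone K -> lin_op L -> lin_op M ->
  (forall f g, K f g ->
     K (fun x => L f x + a * f x) (fun y => M g y + a * g y)) ->
  0 <= t -> K f g -> K (exp_gen L t f) (exp_gen M t g).
Proof.
move=> [h0 hD hl] hL hM hK t0 hfg.
pose L' f x := L f x + a * f x; pose M' g y := M g y + a * g y.
have hL' : lin_op L'.
  by apply: lin_opD => //; apply: lin_opZ; exact: (lin_op_eval (fun x : X => x)).
have hM' : lin_op M'.
  by apply: lin_opD => //; apply: lin_opZ; exact: (lin_op_eval (fun x : Y => x)).
have hit k : K (iter k L' f) (iter k M' g) by elim: k => //= k; exact: hK.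
have scale b f' g' : 0 <= b -> K f' g' -> K (fun x => b * f' x) (fun y => b * g' y).
  move=> b0 h; have := hD b _ _ _ _ b0 h h0.
  by congr K; apply/funext => z; rewrite addr0.
have hs n :
    K (fun x => series (fun k : nat => t ^+ k / k`!%:R * iter k L' f x) n)
      (fun y => series (fun k : nat => t ^+ k / k`!%:R * iter k M' g y) n).
  rewrite /series /=; elim: n => [|n IH].
    by move: h0; congr K; apply/funext => z; rewrite big_geq.
  have := hD (t ^+ n / n`!%:R) _ _ _ _ _ (hit n) IH.
  rewrite divr_ge0 ?exprn_ge0 // => /(_ isT).
  by congr K; apply/funext => z; rewrite big_nat_recr //= addrC.
have hE : K (exp_gen L' t f) (exp_gen M' t g).
  by apply: hl hs _ _ => z; exact: cvg_exp_gen.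
have := scale (expR (- (a * t))) _ _ (expR_ge0 _) hE.
congr K; apply/funext => z;
  by rewrite exp_gen_shift // mulrA -expRD addNr expR0 mul1r.
Qed.

Lemma exp_gen_fixed (X : finType) (L : (X -> R) -> X -> R) t f x :
  lin_op L -> (forall z, L f z = 0) -> exp_gen L t f x = f x.
Proof.
move=> hL hf.
have hd (s : R) z : is_derive s 1 (fun _ : R => f z) (L f z).
  by rewrite hf; exact: is_derive_cst.
exact: esym (exp_gen_ode t x hL hd).
Qed.

(** Positivity of [L + a], applied to the difference of the two functions, preserves the cone of
    ordered pairs. *)
Lemma exp_gen_le (X : finType) (L : (X -> R) -> X -> R) (a t : R) f g :
  lin_op L -> (forall h, (forall x, 0 <= h x) -> forall x, 0 <= L h x + a * h x) ->
  0 <= t -> (forall x, g x <= f x) -> forall x, exp_gen L t g x <= exp_gen L t f x.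
Proof.
move=> hL hpos t0 hgf.
have hid := lin_op_eval (R := R) (fun x : X => x).
have := @exp_gen_cone X X (fun f g => forall x, f x <= g x) L L a t g f.
apply=> //; first exact: closed_cone_le.
move=> {hgf}f {}g hgf x; rewrite -subr_ge0.
have := hpos (fun x => (-1) * f x + g x) _ x.
rewrite lin_op_linear // => h; apply: le_trans (h _) _ => [y|].
  by rewrite mulN1r addrC subr_ge0.
by rewrite !mulN1r; lra.
Qed.

Lemma exp_gen_gt0 (X : finType) (L : (X -> R) -> X -> R) (a t : R) f :
  lin_op L -> (forall h, (forall x, 0 <= h x) -> forall x, 0 <= L h x + a * h x) ->
  (forall x, L (fun=> 1) x = 0) ->
  0 <= t -> (forall x, 0 < f x) -> forall x, 0 < exp_gen L t f x.
Proof.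
move=> hL hpos hL1 t0 f0 x.
(* The constant min f is fixed by the semigroup and stays below [f], which makes the positivity
   strict. *)
have [x0 _ hx0] := arg_minP f (erefl (xpredT x)).
apply: lt_le_trans (f0 x0) _.
have hm z : L (fun=> f x0) z = 0.
  have [l hl] := hL; rewrite hl -mulr_suml.
  have := hL1 z; rewrite hl.
  by under eq_bigr do rewrite mulr1; move=> ->; rewrite mul0r.
rewrite -(exp_gen_fixed t x hL hm).
by apply: (exp_gen_le hL hpos) => // y; exact: hx0.
Qed.

End Cones.

(** * Block shuffles and pairs of tokens *)

Section BlockMean.
Context {R : realType} {n : nat}.
Implicit Types (A : {set 'I_n}) (h : 'S_n -> R).

Definition block_mean A h : R :=
  (\sum_(s : 'S_n | perm_on A s) h s) / (#|A| `!)%:R.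

Lemma eq_block_mean A h h' : (forall s, perm_on A s -> h s = h' s) ->
  block_mean A h = block_mean A h'.
Proof. by move=> hh; congr (_ / _); apply: eq_bigr. Qed.

Lemma block_mean_cst A (a : R) : block_mean A (fun=> a) = a.
Proof.
rewrite /block_mean -big_filter big_const_seq count_predT.
rewrite -[size _]/(size [seq x <- index_enum _ | _]) size_filter.
have -> : count (fun s : 'S_n => perm_on A s) (index_enum 'S_n) = (#|A| `!)%N.
  by rewrite -card_perm cardE /enum_mem size_filter.
by rewrite iter_addr addr0 -[X in X / _]mulr_natr mulfK // pnatr_eq0 -lt0n fact_gt0.
Qed.

Lemma block_mean_ge0 A h : (forall s, perm_on A s -> 0 <= h s) -> 0 <= block_mean A h.
Proof. by move=> hh; rewrite divr_ge0 // sumr_ge0. Qed.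

Lemma block_mean_le A h h' : (forall s, perm_on A s -> h s <= h' s) ->
  block_mean A h <= block_mean A h'.
Proof. by move=> hh; rewrite ler_wpM2r ?invr_ge0 // ler_sum. Qed.

Lemma block_meanD A h h' :
  block_mean A (fun s => h s + h' s) = block_mean A h + block_mean A h'.
Proof. by rewrite /block_mean big_split mulrDl. Qed.

Lemma block_meanZ A a h : block_mean A (fun s => a * h s) = a * block_mean A h.
Proof. by rewrite /block_mean -mulr_sumr mulrA. Qed.

Lemma block_meanZr A a h : block_mean A (fun s => h s * a) = block_mean A h * a.
Proof. by rewrite /block_mean -mulr_suml mulrAC. Qed.

Lemma block_mean_sum A (I : Type) (r : seq I) (P : pred I) (h : I -> 'S_n -> R) :
  block_mean A (fun s => \sum_(i <- r | P i) h i s) =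
  \sum_(i <- r | P i) block_mean A (h i).
Proof. by rewrite /block_mean exchange_big mulr_suml. Qed.

Lemma block_meanV A h : block_mean A (fun s => h (s^-1)%g) = block_mean A h.
Proof.
congr (_ / _); rewrite [RHS](reindex_inj invg_inj) /=.
apply: eq_bigl => s; apply/idP/idP => hs; first exact: perm_onV.
by rewrite -(invgK s); exact: perm_onV.
Qed.

Lemma block_mean_mulr A s0 h : perm_on A s0 ->
  block_mean A (fun s => h (s * s0)%g) = block_mean A h.
Proof.
move=> h0; congr (_ / _); rewrite [RHS](reindex_inj (mulIg s0)) /=.
apply: eq_bigl => s; apply/idP/idP => hs; first exact: perm_onM.
by rewrite -(mulgK s0 s); apply: perm_onM => //; exact: perm_onV.
Qed.

Lemma block_mean_mull A s0 h : perm_on A s0 ->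
  block_mean A (fun s => h (s0 * s)%g) = block_mean A h.
Proof.
move=> h0; congr (_ / _); rewrite [RHS](reindex_inj (mulgI s0)) /=.
apply: eq_bigl => s; apply/idP/idP => hs; first exact: perm_onM.
by rewrite -(mulKg s0 s); apply: perm_onM => //; exact: perm_onV.
Qed.

Lemma perm_on_tperm A i j : i \in A -> j \in A -> perm_on A (tperm i j).
Proof.
move=> iA jA; apply: fintype.subset_trans (tperm_on i j) _.
by apply/fintype.subsetP => k; rewrite !inE => /orP[] /eqP ->.
Qed.

(** Precomposing with a transposition inside [A] shows that all sites of [A] have the same mean;
    summing over these sites, each [s] merely permutes [A]. *)
Lemma block_mean_site A (g : 'I_n -> R) i : i \in A ->
  block_mean A (fun s => g (s i)) = (\sum_(k in A) g k) / #|A|%:R.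
Proof.
move=> iA.
have A0 : #|A|%:R != 0 :> R by rewrite pnatr_eq0 -lt0n; apply/card_gt0P; exists i.
apply: (mulIf A0); rewrite mulfVK //.
have E k : k \in A ->
    block_mean A (fun s => g (s k)) = block_mean A (fun s => g (s i)).
  move=> kA; rewrite -(block_mean_mull _ (perm_on_tperm iA kA)).
  by apply: eq_block_mean => s _; rewrite permM tpermR.
rewrite mulr_natr -sumr_const -(eq_bigr _ E) -block_mean_sum.
rewrite -[RHS](block_mean_cst A); apply: eq_block_mean => s hs.
rewrite [RHS](reindex_inj (@perm_inj _ s)) /=.
by apply: eq_bigl => k; rewrite perm_closed.
Qed.

Lemma lin_op_block_mean (X : finType) (Y : Type) A (q : 'S_n -> Y -> X) :
  lin_op (fun f y => block_mean A (fun s => f (q s y)) : R).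
Proof.
have := lin_opZ (fun=> ((#|A| `!)%:R)^-1)
  (lin_op_sum (index_enum 'S_n) (fun s (_ : Y) => perm_on A s)
     (fun s => lin_op_eval (R := R) (q s))).
by case=> l hl; exists l => f y; rewrite -hl mulrC.
Qed.

End BlockMean.

(** * Generators of the shuffle and of the killed pair of tokens *)

Section Shuffle.
Context {R : realType} {n : nat}.
Variable c : {set 'I_n} -> R.
Hypothesis hc : forall A, 0 <= c A.
Implicit Types (A : {set 'I_n}) (f : 'S_n -> R) (g : 'I_n * 'I_n -> R).

Definition shuffle_pair (s : 'S_n) (p : 'I_n * 'I_n) := (s p.1, s p.2).

Definition in_block A (p : 'I_n * 'I_n) := (p.1 \in A) && (p.2 \in A).

(* The two tokens are killed when they are shuffled together. *)
Definition pair_block A g p : R :=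
  if in_block A p then 0 else block_mean A (fun s => g (shuffle_pair s p)).

Definition pair_generator g p : R := \sum_A c A * (pair_block A g p - g p).

Lemma shuffle_generatorE f x : shuffle_generator c f x =
  \sum_A c A * (block_mean A (fun s => f (s * x)%g) - f x).
Proof.
apply: eq_bigr => A _; rewrite sumrB -[in RHS](block_mean_cst A (f x)).
by rewrite /block_mean -mulrBl mulrAC mulrA.
Qed.

Lemma lin_op_shuffle : lin_op (shuffle_generator c).
Proof.
case: (lin_op_sum (index_enum {set 'I_n}) (fun _ (_ : 'S_n) => true)
  (fun A => lin_opZ (fun=> c A) (lin_opB
     (lin_op_block_mean A (fun s x => (s * x)%g))
     (lin_op_eval (fun x : 'S_n => x))))) => l hl.
by exists l => f x; rewrite -hl shuffle_generatorE.
Qed.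

Lemma lin_op_pair_block A : lin_op (pair_block A).
Proof.
have [l hl] := lin_opZ (fun p => (~~ in_block A p)%:R)
  (@lin_op_block_mean R n ('I_n * 'I_n)%type _ A shuffle_pair).
exists l => g p; rewrite -hl /pair_block.
by case: ifP => _ /=; rewrite ?mul0r ?mul1r.
Qed.

Lemma lin_op_pair_generator : lin_op pair_generator.
Proof.
case: (lin_op_sum (index_enum {set 'I_n}) (fun _ _ => true)
  (fun A => lin_opZ (fun=> c A) (lin_opB (lin_op_pair_block A)
     (lin_op_eval (fun x : 'I_n * 'I_n => x))))) => l hl.
by exists l => f x; rewrite -hl.
Qed.

(** Adding the total rate leaves a nonnegative combination of block averages, so that preservation
    of a cone can be checked block by block. *)
Lemma shuffle_generator_shift f x :
  shuffle_generator c f x + (\sum_A c A) * f x =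
  \sum_A c A * block_mean A (fun s => f (s * x)%g).
Proof.
rewrite shuffle_generatorE mulr_suml -big_split; apply: eq_bigr => A _ /=.
by rewrite mulrBr subrK.
Qed.

Lemma pair_generator_shift g p :
  pair_generator g p + (\sum_A c A) * g p = \sum_A c A * pair_block A g p.
Proof.
rewrite mulr_suml -big_split; apply: eq_bigr => A _ /=.
by rewrite mulrBr subrK.
Qed.

Lemma shuffle_generator_pos f : (forall x, 0 <= f x) ->
  forall x, 0 <= shuffle_generator c f x + (\sum_A c A) * f x.
Proof.
move=> f0 x; rewrite shuffle_generator_shift sumr_ge0 // => A _.
by rewrite mulr_ge0 // block_mean_ge0.
Qed.

Lemma pair_block_ge0 A g : (forall p, 0 <= g p) -> forall p, 0 <= pair_block A g p.
Proof. by move=> g0 p; rewrite /pair_block; case: ifP => // _; exact: block_mean_ge0. Qed.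

Lemma shuffle_generator_cst a x : shuffle_generator c (fun=> a) x = 0.
Proof.
by rewrite shuffle_generatorE big1 // => A _; rewrite block_mean_cst subrr mulr0.
Qed.

Lemma shuffle_generator_sym f f' :
  \sum_x f' x * shuffle_generator c f x = \sum_x shuffle_generator c f' x * f x.
Proof.
under eq_bigr do rewrite shuffle_generatorE mulr_sumr.
under [RHS]eq_bigr do rewrite shuffle_generatorE mulr_suml.
rewrite exchange_big [RHS]exchange_big; apply: eq_bigr => A _ /=.
under eq_bigr do rewrite mulrCA mulrBr.
under [RHS]eq_bigr do rewrite -mulrA mulrBl.
rewrite -!mulr_sumr; congr (_ * _); rewrite !sumrB; congr (_ - _).
under eq_bigr do rewrite -block_meanZ.
under [RHS]eq_bigr do rewrite -block_meanZr -block_meanV.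
rewrite -!block_mean_sum; apply: eq_block_mean => s _.
rewrite [RHS](reindex_inj (mulgI s)) /=; apply: eq_bigr => x _.
by rewrite mulKg.
Qed.

(** Each move is undone by the inverse permutation, which is equally likely, and a permutation on
    [A] does not change whether a pair lies in [A], so killing is symmetric too. *)
Lemma pair_generator_sym g g' :
  \sum_p g' p * pair_generator g p = \sum_p pair_generator g' p * g p.
Proof.
under eq_bigr do rewrite mulr_sumr.
under [RHS]eq_bigr do rewrite mulr_suml.
rewrite exchange_big [RHS]exchange_big; apply: eq_bigr => A _ /=.
under eq_bigr do rewrite mulrCA mulrBr.
under [RHS]eq_bigr do rewrite -mulrA mulrBl.
rewrite -!mulr_sumr; congr (_ * _); rewrite !sumrB; congr (_ - _).
have E g1 p : pair_block A g1 p =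
    block_mean A (fun s => (~~ in_block A p)%:R * g1 (shuffle_pair s p)).
  rewrite /pair_block; case: ifP => _ /=; rewrite block_meanZ ?mul0r ?mul1r //.
under eq_bigr do rewrite E -block_meanZ.
under [RHS]eq_bigr do rewrite E -block_meanZr -block_meanV.
rewrite -!block_mean_sum; apply: eq_block_mean => s hs.
have bij : injective (shuffle_pair s).
  by move=> [i j] [i' j'] [] /perm_inj -> /perm_inj ->.
rewrite [RHS](reindex_inj bij) /=; apply: eq_bigr => -[i j] _.
rewrite /in_block /shuffle_pair /= !perm_closed // !permK; ring.
Qed.

End Shuffle.

(** * Entropy production along transpositions *)

Lemma ln_leB1 (R : realType) (x : R) : 0 < x -> ln x <= x - 1.
Proof. by move=> x0; rewrite -[in ln x](subrKC 1 x); apply: le_ln1Dx; lra. Qed.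

Section TranspositionEnergy.
Context {R : realType} {n : nat}.
Variable c : {set 'I_n} -> R.
Hypothesis hc : forall A, 0 <= c A.
Implicit Types (A : {set 'I_n}) (f : 'S_n -> R) (g : 'I_n * 'I_n -> R).

Definition transpose (p : 'I_n * 'I_n) (x : 'S_n) : 'S_n := (tperm p.1 p.2 * x)%g.

Lemma transposeK p : involutive (transpose p).
Proof. by move=> x; rewrite /transpose mulgA tperm2 mul1g. Qed.

(** Conjugation turns a transposition into that of the moved points; this is how two tokens sharing
    the shuffles arise. *)
Lemma transpose_mul p s x :
  (s * transpose p x)%g = transpose (shuffle_pair (s^-1)%g p) (s * x)%g.
Proof. by rewrite /transpose -tpermJ /conjg invgK -!mulgA mulKg. Qed.

Definition transposition_energy f p : R :=
  \sum_x (f x - f (transpose p x)) * (ln (f x) - ln (f (transpose p x))).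

(* The tangent plane at (e^r, 1) of the convex and 1-homogeneous function
   (a, b) |-> (a - b) (ln a - ln b). *)
Definition entropy_tangent (a b r : R) : R :=
  a * (r + 1 - expR (- r)) + b * (1 - r - expR r).

(** Add [ln x <= x - 1] at x = (b / a) e^r, multiplied by [a], and at the inverse of that point,
    multiplied by [b]. *)
Lemma entropy_tangent_le a b r : 0 < a -> 0 < b ->
  entropy_tangent a b r <= (a - b) * (ln a - ln b).
Proof.
move=> a0 b0; rewrite /entropy_tangent.
have h1 : ln b - ln a + r <= b / a * expR r - 1.
  have := @ln_leB1 R (b / a * expR r); rewrite mulr_gt0 ?divr_gt0 ?expR_gt0 //.
  by move=> /(_ isT); rewrite lnM ?ln_div ?expRK ?posrE ?divr_gt0 ?expR_gt0.
have h2 : ln a - ln b - r <= a / b * expR (- r) - 1.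
  have := @ln_leB1 R (a / b * expR (- r)); rewrite mulr_gt0 ?divr_gt0 ?expR_gt0 //.
  by move=> /(_ isT); rewrite lnM ?ln_div ?expRK ?posrE ?divr_gt0 ?expR_gt0.
have h1a : a * (ln b - ln a + r) <= b * expR r - a.
  apply: le_trans (ler_wpM2l (ltW a0) h1) _.
  by rewrite mulrBr mulr1 mulrA mulrCA divff ?gt_eqF // mulr1.
have h2b : b * (ln a - ln b - r) <= a * expR (- r) - b.
  apply: le_trans (ler_wpM2l (ltW b0) h2) _.
  by rewrite mulrBr mulr1 mulrA mulrCA divff ?gt_eqF // mulr1.
lra.
Qed.

Lemma entropy_tangent_eq a b : 0 < a -> 0 < b ->
  entropy_tangent a b (ln a - ln b) = (a - b) * (ln a - ln b).
Proof.
move=> a0 b0; rewrite /entropy_tangent opprB !expRB !lnK ?posrE //.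
rewrite mulrBr mulrCA divff ?gt_eqF // mulrBr mulrCA divff ?gt_eqF //; ring.
Qed.

(** The coefficient of [a] is 2 - e^r - e^{-r}. *)
Lemma entropy_tangent_diag_le0 a r : 0 <= a -> entropy_tangent a a r <= 0.
Proof.
move=> a0; rewrite /entropy_tangent -mulrDr mulr_ge0_le0 //.
have := expR_ge1Dx r; have := expR_ge1Dx (- r); lra.
Qed.

Lemma transposition_energy_ge0 f p : (forall x, 0 < f x) ->
  0 <= transposition_energy f p.
Proof.
move=> f0; apply: sumr_ge0 => x _.
have := entropy_tangent_le 0 (f0 x) (f0 (transpose p x)).
by rewrite /entropy_tangent oppr0 expR0 add0r addr0 subrr !mulr0 add0r.
Qed.

Lemma transposition_energy_diag f i : transposition_energy f (i, i) = 0.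
Proof.
by apply: big1 => x _; rewrite /transpose /= tperm1 mul1g subrr mul0r.
Qed.

(** One free slope per permutation. For positive [f] the energy is the supremum over the slopes, so
    bounding it amounts to a family of inequalities that are linear in [f] and cut out a cone. *)
Definition energy_tangent f (i : ('I_n * 'I_n) * ('S_n -> R)) : R :=
  \sum_x entropy_tangent (f x) (f (transpose i.1 x)) (i.2 x).

Lemma lin_op_energy_tangent : lin_op energy_tangent.
Proof.
have [l hl] := lin_op_sum (index_enum 'S_n)
  (fun x (_ : ('I_n * 'I_n) * ('S_n -> R)) => true) (fun x => lin_opD
    (lin_opZ (fun i : ('I_n * 'I_n) * ('S_n -> R) => i.2 x + 1 - expR (- i.2 x))
       (lin_op_eval (fun _ => x)))
    (lin_opZ (fun i : ('I_n * 'I_n) * ('S_n -> R) => 1 - i.2 x - expR (i.2 x))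
       (lin_op_eval (fun i => transpose i.1 x)))).
exists l => f i; rewrite -hl; apply: eq_bigr => x _.
by rewrite /entropy_tangent mulrC; congr (_ + _); rewrite mulrC.
Qed.

(** If both points lie in [A], averaging makes the two arguments of each tangent equal. Otherwise
    the hypothesis is averaged over [s], with the pair and the slopes transported by [s]. *)
Lemma energy_tangent_block A f g : (forall x, 0 <= f x) ->
  (forall i, energy_tangent f i <= g i.1) ->
  forall i, energy_tangent (fun x => block_mean A (fun s => f (s * x)%g)) i
            <= pair_block A g i.1.
Proof.
move=> f0 hfg [p r] /=; rewrite /pair_block; case: ifP => [/andP[iA jA]|_].
  apply: sumr_le0 => x _ /=.
  have -> : block_mean A (fun s => f (s * transpose p x)%g) =
            block_mean A (fun s => f (s * x)%g).
    rewrite -[RHS](block_mean_mulr _ (perm_on_tperm iA jA)).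
    by apply: eq_block_mean => s _; rewrite mulgA.
  by apply: entropy_tangent_diag_le0; exact: block_mean_ge0.
(* The pair moves by the inverse of [s] in [transpose_mul], hence the change of variable. *)
rewrite -[leRHS]block_meanV /energy_tangent.
under eq_bigr => x _ do rewrite /entropy_tangent -!block_meanZr -block_meanD.
rewrite -block_mean_sum; apply: block_mean_le => s _ /=.
apply: le_trans (hfg (shuffle_pair (s^-1)%g p, fun x => r (s^-1 * x)%g)).
rewrite /energy_tangent [leRHS](reindex_inj (mulgI s)) /=.
by apply: ler_sum => x _; rewrite mulKg transpose_mul.
Qed.

(** The cone of tangent inequalities is carried from time 0 to time [t]; then the slopes are chosen
    as the log-ratios of [ft], where the tangent planes touch. *)
Lemma transposition_energy_exp f t p : 0 <= t -> (forall x, 0 < f x) ->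
  transposition_energy (exp_gen (shuffle_generator c) t f) p <=
  exp_gen (pair_generator c) t (transposition_energy f) p.
Proof.
move=> t0 f0; set ft := exp_gen _ t f; set gt := exp_gen _ t _.
have ft0 : forall x, 0 < ft x.
  apply: (exp_gen_gt0 (a := \sum_A c A)) => //; first exact: lin_op_shuffle.
    exact: shuffle_generator_pos.
  by move=> x; exact: shuffle_generator_cst.
pose K f g := (forall x : 'S_n, 0 <= f x) /\
  (forall i, energy_tangent f i <= g i.1).
have hK : K ft gt.
  apply: (exp_gen_cone (a := \sum_A c A)) t0 _.
  - apply: closed_cone_and; first exact: closed_cone_ge0.
    by apply: closed_cone_le; [exact: lin_op_energy_tangent | exact: lin_op_eval].
  - exact: lin_op_shuffle.
  - exact: lin_op_pair_generator.
  - move=> {f f0 ft gt ft0} f g [f0 hfg].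
    split=> [|i]; first exact: shuffle_generator_pos.
    rewrite pair_generator_shift //.
    have -> : (fun x => shuffle_generator c f x + (\sum_A c A) * f x) =
        fun x => \sum_A c A * block_mean A (fun s => f (s * x)%g).
      by apply/funext => x; rewrite shuffle_generator_shift.
    rewrite (lin_op_lin_sum _ _ _ _ _ lin_op_energy_tangent).
    apply: ler_sum => A _; rewrite ler_wpM2l //.
    exact: (energy_tangent_block A f0 hfg).
  - split=> [x|[q r]]; first exact: ltW.
    by apply: ler_sum => x _; exact: entropy_tangent_le.
have [_ /(_ (p, fun x => ln (ft x) - ln (ft (transpose p x))))] := hK.
apply: le_trans; rewrite /energy_tangent /=.
by apply: ler_sum => x _; rewrite entropy_tangent_eq.
Qed.

Definition pair_survival t p : R :=
  exp_gen (pair_generator c) t (fun q => (q.1 != q.2)%:R) p.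

(** The energy vanishes on the diagonal, so its sum is a pairing with the indicator of distinct
    tokens; by symmetry the semigroup moves onto that indicator. *)
Lemma sum_transposition_energy_exp f t : 0 <= t -> (forall x, 0 < f x) ->
  \sum_p transposition_energy (exp_gen (shuffle_generator c) t f) p <=
  \sum_p transposition_energy f p * pair_survival t p.
Proof.
move=> t0 f0.
rewrite (exp_gen_adjoint _ _ _ (lin_op_pair_generator c)); last first.
  by move=> g g'; exact: pair_generator_sym.
apply: ler_sum => -[i j] _ /=; case: (eqVneq i j) => [->|_].
  by rewrite transposition_energy_diag mulr0.
by rewrite mulr1; exact: transposition_energy_exp.
Qed.

Lemma sum_transposition_energy_contract f t a : 0 <= t -> (forall x, 0 < f x) ->
  (forall i j, i != j -> pair_survival t (i, j) <= a) ->
  \sum_p transposition_energy (exp_gen (shuffle_generator c) t f) p <=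
  a * \sum_p transposition_energy f p.
Proof.
move=> t0 f0 ha; apply: le_trans (sum_transposition_energy_exp t0 f0) _.
rewrite mulr_sumr; apply: ler_sum => -[i j] _; rewrite mulrC.
case: (eqVneq i j) => [->|ij]; first by rewrite transposition_energy_diag !mulr0.
by rewrite ler_wpM2r ?transposition_energy_ge0 // ha.
Qed.

End TranspositionEnergy.

(** * Comparison with independent walks *)

Section TwoWalks.
Context {R : realType} {X : finType}.
Variable chat : X -> X -> R.
Implicit Types (w : X * X -> R) (p : X * X).

Definition two_walk_generator w p : R :=
  walk_generator chat (fun i => w (i, p.2)) p.1
  + walk_generator chat (fun j => w (p.1, j)) p.2.

Lemma lin_op_walk_generator : lin_op (walk_generator chat).
Proof.
have [l hl] := lin_op_sum (index_enum X) (fun l k => l != k)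
  (fun l => lin_opZ (chat^~ l) (lin_opB (lin_op_eval (fun _ => l)) (lin_op_eval id))).
by exists l => f k; rewrite -hl.
Qed.

Lemma lin_op_two_walk_generator : lin_op two_walk_generator.
Proof.
have [l hl] := lin_op_walk_generator.
have [m hm] := lin_opD
  (lin_op_sum (index_enum X) (fun _ (_ : X * X) => true)
     (fun k => lin_opZ (fun p : X * X => l p.1 k)
        (lin_op_eval (fun p : X * X => (k, p.2)))))
  (lin_op_sum (index_enum X) (fun _ (_ : X * X) => true)
     (fun k => lin_opZ (fun p : X * X => l p.2 k)
        (lin_op_eval (fun p : X * X => (p.1, k))))).
by exists m => f p; rewrite -hm /two_walk_generator !hl.
Qed.

(** The product of the two one-walk kernels solves the evolution equation of
    [two_walk_generator]. *)
Lemma exp_two_walk_generator t w i j : exp_gen two_walk_generator t w (i, j) =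
  \sum_k \sum_l exp_mx (walk_generator chat) t i k
    * exp_mx (walk_generator chat) t j l * w (k, l).
Proof.
set G := walk_generator chat; have hG : lin_op G := lin_op_walk_generator.
pose y s p := \sum_k exp_mx G s p.1 k * exp_gen G s (fun l => w (k, l)) p.2.
have hd (s : R) p : is_derive s 1 (fun r => y r p) (two_walk_generator (y s) p).
  have := is_derive1_sum (index_enum X) (P := xpredT) (fun k _ =>
    is_derive1M (is_derive_exp_mx hG s p.1 k)
      (is_derive_exp_gen hG (fun l => w (k, l)) p.2 s)).
  rewrite big_split /=; congr (is_derive _ _ _ (_ + _)).
    transitivity (G (fun i => \sum_k exp_gen G s (fun l => w (k, l)) p.2 * exp_mx G s i k) p.1).
      rewrite lin_op_lin_sum //; apply: eq_bigr => k _.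
      by rewrite exp_gen_generator // mulrC.
    congr (G _ _); apply/funext => u.
    by apply: eq_bigr => k _; rewrite mulrC.
  transitivity (G (fun j => \sum_k exp_mx G s p.1 k * exp_gen G s (fun l => w (k, l)) j) p.2).
    rewrite lin_op_lin_sum //; apply: eq_bigr => k _.
    by rewrite exp_gen_generator.
  by [].
transitivity (exp_gen two_walk_generator t (y 0) (i, j)).
  congr (exp_gen _ _ _ _); apply/funext => -[k l]; rewrite /y /=.
  rewrite (bigD1 k) //= /exp_mx !exp_gen0 // eqxx mul1r big1 ?addr0 // => u /negbTE.
  by rewrite !exp_gen0 // eq_sym => ->; rewrite mul0r.
rewrite -(exp_gen_ode t (i, j) lin_op_two_walk_generator hd) /y /=.
apply: eq_bigr => k _; rewrite exp_genE // mulr_sumr.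
by apply: eq_bigr => l _; rewrite mulrA.
Qed.

(* The probability that two independent walks, observed at the m + 1 times
   0, h, ..., m h, are never seen at the same site. *)
Definition avoidance h m : X * X -> R :=
  iter m (fun w p => (p.1 != p.2)%:R * exp_gen two_walk_generator h w p)
    (fun p => (p.1 != p.2)%:R).

End TwoWalks.

(** * Pair survival is a pseudometric, dominated by the avoidance of independent walks *)

Section Comparison.
Context {R : realType} {n : nat}.
Variable c : {set 'I_n} -> R.
Hypothesis hc : forall A, 0 <= c A.
Implicit Types (A : {set 'I_n}) (w : 'I_n * 'I_n -> R).

Definition pseudometric w : Prop :=
  [/\ forall p, 0 <= w p, forall i, w (i, i) <= 0 &
      forall i j k, w (i, j) <= w (i, k) + w (k, j)].

(** A shuffle of [A] sends a site of [A] to a uniform site of [A], so it causes each given jump at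
    rate c(A) / |A|. *)
Lemma walk_generator_conductance f k : walk_generator (conductance c) f k =
  \sum_A c A * (block_mean A (fun s => f (s k)) - f k).
Proof.
rewrite /walk_generator /conductance.
under eq_bigr do rewrite mulr_suml big_mkcond /=.
rewrite exchange_big /=; apply: eq_bigr => A _.
have [kA|kA] := boolP (k \in A); last first.
  rewrite big1 => [|l _]; last first.
    by rewrite finset.subUset finset.sub1set (negbTE kA).
  rewrite (@eq_block_mean _ _ _ _ (fun=> f k)) => [|s hs].
    by rewrite block_mean_cst subrr mulr0.
  by rewrite (out_perm hs).
have A0 : #|A|%:R != 0 :> R by rewrite pnatr_eq0 -lt0n; apply/card_gt0P; exists k.
have -> : block_mean A (fun s => f (s k)) - f k = (\sum_(l in A) (f l - f k)) / #|A|%:R.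
  by rewrite block_mean_site // sumrB sumr_const mulrBl -[X in _ = _ - X / _]mulr_natr mulfK.
rewrite mulrA mulrAC mulr_sumr big_mkcond [RHS]big_mkcond /=; apply: eq_bigr => l _.
rewrite finset.subUset !finset.sub1set kA /=.
(* The site l = k occurs only in the sum over [A], where its term is zero. *)
by case: eqVneq => [->|_] /=; rewrite ?kA ?subrr ?mulr0.
Qed.

Lemma two_walk_generatorE w i j : two_walk_generator (conductance c) w (i, j) =
  \sum_A c A * (block_mean A (fun s => w (s i, j))
                + block_mean A (fun s => w (i, s j)) - 2 * w (i, j)).
Proof.
rewrite /two_walk_generator /= !walk_generator_conductance -big_split.
by apply: eq_bigr => A _ /=; ring.
Qed.

Lemma two_walk_generator_pos w : (forall p, 0 <= w p) ->
  forall p, 0 <= two_walk_generator (conductance c) w p + 2 * (\sum_A c A) * w p.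
Proof.
move=> w0 [i j]; rewrite two_walk_generatorE mulrAC mulr_sumr -big_split.
apply: sumr_ge0 => A _ /=; rewrite [2 * _ * _]mulrC -mulrDr subrK.
by rewrite mulr_ge0 // addr_ge0 // block_mean_ge0.
Qed.

(** The delicate case is a killed pair on the right, say [i] and [k] in [A] but [j] outside: then
    [s i] and [s k] have the same law while [j] stays put, so the other two terms agree. When no
    pair on the right is killed, average the triangle inequality. *)
Lemma pair_block_pseudometric A w : pseudometric w -> pseudometric (pair_block A w).
Proof.
case=> w0 wd wt; split; first exact: pair_block_ge0.
  move=> i; rewrite /pair_block; case: ifP => // _.
  rewrite -[leRHS](block_mean_cst A 0); apply: block_mean_le => s _; exact: wd.
move=> i j k; rewrite /pair_block /in_block /shuffle_pair /=.
have site (g : 'I_n -> R) u v : u \in A -> v \in A ->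
    block_mean A (fun s => g (s u)) = block_mean A (fun s => g (s v)).
  by move=> uA vA; rewrite !block_mean_site.
have out u s : u \notin A -> perm_on A s -> s u = u by move=> uA hs; exact: out_perm hs uA.
have [iA|iA] := boolP (i \in A); have [jA|jA] := boolP (j \in A) => /=.
- by rewrite addr_ge0 //; case: ifP => // _; exact: block_mean_ge0.
- have [kA|kA] := boolP (k \in A); last first.
    by rewrite -block_meanD; apply: block_mean_le.
  rewrite add0r.
  have E u : block_mean A (fun s => w (s u, s j)) = block_mean A (fun s => w (s u, j)).
    by apply: eq_block_mean => s hs; rewrite (out j).
  by rewrite !E (site (fun u => w (u, j)) i k).
- have [kA|kA] := boolP (k \in A); last first.
    by rewrite -block_meanD; apply: block_mean_le.
  rewrite addr0.
  have E u : block_mean A (fun s => w (s i, s u)) = block_mean A (fun s => w (i, s u)).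
    by apply: eq_block_mean => s hs; rewrite (out i).
  by rewrite !E (site (fun u => w (i, u)) j k).
- by rewrite andbF -block_meanD; apply: block_mean_le.
Qed.

(** If at most one token lies in [A], both sides agree. If both do, the left side is - w (i, j) and
    the claim is the triangle inequality through a uniform site of [A]. *)
Lemma pair_block_le_walks A w i j : pseudometric w ->
  pair_block A w (i, j) - w (i, j) <=
  block_mean A (fun s => w (s i, j)) + block_mean A (fun s => w (i, s j)) - 2 * w (i, j).
Proof.
case=> w0 wd wt; rewrite /pair_block /in_block /shuffle_pair /=.
have out u s : u \notin A -> perm_on A s -> s u = u by move=> uA hs; exact: out_perm hs uA.
have [iA|iA] := boolP (i \in A); have [jA|jA] := boolP (j \in A) => /=.
- suff : w (i, j) <= block_mean A (fun s => w (s i, j)) + block_mean A (fun s => w (i, s j)).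
    lra.
  (* [s i] and [s j] are both uniform on [A], so one intermediate site serves both means. *)
  rewrite (block_mean_site (fun u => w (i, u)) jA) -(block_mean_site (fun u => w (i, u)) iA).
  rewrite -block_meanD -[leLHS](block_mean_cst A); apply: block_mean_le => s _.
  by rewrite addrC.
- have -> : block_mean A (fun s => w (s i, s j)) = block_mean A (fun s => w (s i, j)).
    by apply: eq_block_mean => s hs; rewrite (out j).
  have -> : block_mean A (fun s => w (i, s j)) = w (i, j).
    by rewrite -[RHS](block_mean_cst A); apply: eq_block_mean => s hs; rewrite (out j).
  lra.
- have -> : block_mean A (fun s => w (s i, s j)) = block_mean A (fun s => w (i, s j)).
    by apply: eq_block_mean => s hs; rewrite (out i).
  have -> : block_mean A (fun s => w (s i, j)) = w (i, j).
    by rewrite -[RHS](block_mean_cst A); apply: eq_block_mean => s hs; rewrite (out i).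
  lra.
- have -> : block_mean A (fun s => w (s i, s j)) = w (i, j).
    by rewrite -[RHS](block_mean_cst A); apply: eq_block_mean => s hs; rewrite !out.
  have -> : block_mean A (fun s => w (i, s j)) = w (i, j).
    by rewrite -[RHS](block_mean_cst A); apply: eq_block_mean => s hs; rewrite (out j).
  have -> : block_mean A (fun s => w (s i, j)) = w (i, j).
    by rewrite -[RHS](block_mean_cst A); apply: eq_block_mean => s hs; rewrite (out i).
  lra.
Qed.

Lemma pseudometricD a w w' : 0 <= a -> pseudometric w -> pseudometric w' ->
  pseudometric (fun p => a * w p + w' p).
Proof.
move=> a0 [w0 wd wt] [w0' wd' wt']; split=> [p|i|i j k].
- by rewrite addr_ge0 // mulr_ge0.
- by rewrite -[leRHS]addr0 lerD // mulr_ge0_le0.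
- have := ler_wpM2l a0 (wt i j k); have := wt' i j k; lra.
Qed.

Lemma pseudometric0 : pseudometric (fun=> 0).
Proof. by split=> // *; rewrite addr0. Qed.

Lemma pseudometric_sum (a : {set 'I_n} -> R) (w : {set 'I_n} -> 'I_n * 'I_n -> R) :
  (forall A, 0 <= a A) -> (forall A, pseudometric (w A)) ->
  pseudometric (fun p => \sum_A a A * w A p).
Proof.
move=> a0 hw; elim: (index_enum _) => [|A r IH].
  have -> : (fun p => \sum_(A <- [::]) a A * w A p) = fun=> 0.
    by apply/funext => p; rewrite big_nil.
  exact: pseudometric0.
have -> : (fun p => \sum_(A <- A :: r) a A * w A p) =
    fun p => a A * w A p + \sum_(A <- r) a A * w A p.
  by apply/funext => p; rewrite big_cons.
exact: pseudometricD.
Qed.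

Lemma closed_cone_pseudometric (X : finType) :
  closed_cone (fun (_ : X -> R) w => pseudometric w).
Proof.
split=> [|a _ w _ w' a0|_ v _ w hv _ hw]; first exact: pseudometric0.
  exact: pseudometricD.
split=> [p|i|i j k].
- by apply: ler_cvg_to (cvg_cst (0 : R)) (hw p) _; apply: nearW => m; have [] := hv m.
- by apply: ler_cvg_to (hw (i, i)) (cvg_cst (0 : R)) _; apply: nearW => m; have [] := hv m.
- apply: ler_cvg_to (hw (i, j)) (cvgD (hw (i, k)) (hw (k, j))) _.
  by apply: nearW => m; have [_ _ ht] := hv m; exact: ht.
Qed.

(** The block comparison holds only for pseudometrics, so that property and the inequality are
    propagated together in one cone. *)
Lemma exp_pair_le_exp_walks t f w : 0 <= t ->
  pseudometric w -> (forall p, w p <= f p) ->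
  pseudometric (exp_gen (pair_generator c) t w) /\
  (forall p, exp_gen (pair_generator c) t w p <=
             exp_gen (two_walk_generator (conductance c)) t f p).
Proof.
move=> t0 hw hwf.
(* The signs put [f] on the left, as the form of [closed_cone_le] demands. *)
pose K (f w : 'I_n * 'I_n -> R) := pseudometric w /\ (forall p, -1 * f p <= -1 * w p).
have hK f' : (forall p, -1 * f' p <= -1 * w p) <-> (forall p, w p <= f' p).
  by split=> h p; have := h p; rewrite !mulN1r lerN2.
have hcone : closed_cone K.
  apply: closed_cone_and; first exact: closed_cone_pseudometric.
  by apply: closed_cone_le; apply: lin_opZ; exact: (lin_op_eval (fun p => p)).
suff : K (exp_gen (two_walk_generator (conductance c)) t f)
         (exp_gen (pair_generator c) t w).
  by case=> h h'; split=> // p; have := h' p; rewrite !mulN1r lerN2.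
(* Twice the total rate, since each of the two walks moves on its own. *)
apply: (exp_gen_cone (a := 2 * \sum_A c A)) hcone _ _ _ t0 _.
- exact: lin_op_two_walk_generator.
- exact: lin_op_pair_generator.
- move=> {hK f w hw hwf} f w [hw hwf]; split.
    have -> : (fun p => pair_generator c w p + 2 * (\sum_A c A) * w p) =
        fun p => \sum_A c A * (1 * pair_block A w p + w p).
      apply/funext => p; rewrite [2 * _]mulrC -mulrA mulr_suml -big_split.
      by apply: eq_bigr => A _ /=; ring.
    apply: pseudometric_sum => // A; apply: pseudometricD => //.
    exact: pair_block_pseudometric.
  move=> [i j]; rewrite !mulN1r lerN2.
  (* Monotonicity of the walk operator: positivity applied to [f - w]. *)
  have h0 := @two_walk_generator_pos (fun p => (-1) * w p + f p) _ (i, j).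
  apply: le_trans (_ : two_walk_generator (conductance c) w (i, j)
     + 2 * (\sum_A c A) * w (i, j) <= _).
    rewrite lerD2r two_walk_generatorE; apply: ler_sum => A _.
    by rewrite ler_wpM2l //; exact: pair_block_le_walks.
  have {}h0 : 0 <= two_walk_generator (conductance c) (fun p => -1 * w p + f p) (i, j)
      + 2 * (\sum_A c A) * (- 1 * w (i, j) + f (i, j)).
    by apply: h0 => p; have := hwf p; rewrite !mulN1r; lra.
  move: h0; rewrite lin_op_linear; last exact: lin_op_two_walk_generator.
  lra.
- by split=> // p; rewrite !mulN1r lerN2.
Qed.

Lemma pair_survival_pseudometric t : 0 <= t -> pseudometric (pair_survival c t).
Proof.
move=> t0; have [] // := @exp_pair_le_exp_walks t
  (fun q => (q.1 != q.2)%:R) (fun q => (q.1 != q.2)%:R) t0.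
split=> [p|i|i j k] //=; first by rewrite eqxx.
case: (eqVneq i k) => [->|_]; first by rewrite add0r.
by case: (i != j) => //=; rewrite ?addr_ge0 // lerDl.
Qed.

(** Each grid step uses the comparison of semigroups; restricting the walks to distinct sites at the
    grid time costs nothing because pair survival vanishes on the diagonal. *)
Lemma pair_survival_le_avoidance (h : R) m p : 0 <= h ->
  pair_survival c (m%:R * h) p <= avoidance (conductance c) h m p.
Proof.
move=> h0; elim: m p => [|m IH] p.
  by rewrite mul0r /pair_survival exp_gen0 //; exact: lin_op_pair_generator.
have mh : 0 <= m%:R * h by rewrite mulr_ge0.
have [_ /(_ p)] := exp_pair_le_exp_walks h0 (pair_survival_pseudometric mh) IH.
rewrite /pair_survival -natr1 mulrDl mul1r exp_genD; last exact: lin_op_pair_generator.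
set v := exp_gen _ h _ p => hv.
have vd : p.1 = p.2 -> v <= 0.
  rewrite /v -exp_genD; last exact: lin_op_pair_generator.
  case: {hv v} p => i j /= ->.
  by have [_ hd _] := pair_survival_pseudometric (addr_ge0 mh h0); exact: hd.
apply: le_trans (_ : (p.1 != p.2)%:R * exp_gen (two_walk_generator (conductance c)) h
                 (avoidance (conductance c) h m) p <= _) => //.
move: v hv vd => v hv vd; have [/vd|_] := eqVneq p.1 p.2; first by rewrite mul0r.
by rewrite mul1r.
Qed.

End Comparison.

(** * Meeting times *)

Section MeetingTime.
Context {R : realType} {d : measure_display} {Omega : measurableType d} {X : finType}.
Implicit Types (P : probability Omega R) (Z : Omega -> X) (A E F : set Omega).

Lemma EFin_fine_probability P A : measurable A -> (fine (P A))%:E = P A.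
Proof. by move=> mA; rewrite fineK // fin_num_measure. Qed.

Lemma total_probability P Z A : measurable A ->
  (forall x, measurable (Z @^-1` [set x])) ->
  fine (P A) = \sum_x fine (P (A `&` Z @^-1` [set x])).
Proof.
move=> mA mZ.
have AE : A = \bigcup_(x in [set` index_enum X]) (A `&` Z @^-1` [set x]).
  apply/seteqP; split=> [w Aw|w [x _ []] //].
  by exists (Z w) => //=; exact: mem_index_enum.
suff -> : P A = (\sum_x fine (P (A `&` Z @^-1` [set x])))%:E by [].
rewrite {1}AE measure_fin_bigcup //.
- rewrite -fsbig_seq ?index_enum_uniq // -sumEFin; apply: eq_bigr => x _.
  by apply/esym/EFin_fine_probability; exact: measurableI.
- by move=> x y _ _ [w [[_ <-] [_ <-]]].
- by move=> x _; exact: measurableI.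
Qed.

Lemma sigma_processI (I : R -> Omega -> X) (D : set R) E F :
  sigma_process I D E -> sigma_process I D F -> sigma_process I D (E `&` F).
Proof.
have sub A : sigma_process I D A -> A `<=` setT by [].
by have [_ _ _ hI] := (sigma_algebraP sub).1 (smallest_sigma_algebra _ _); exact: hI.
Qed.

Lemma sigma_process_le (I : R -> Omega -> X) (D D' : set R) E :
  D `<=` D' -> sigma_process I D E -> sigma_process I D' E.
Proof.
move=> DD'; apply: sub_sigma_algebra2 => A [s Ds hA]; exists s => //; exact: DD'.
Qed.

Lemma sigma_process_fiber (I : R -> Omega -> X) (D : set R) s k :
  D s -> sigma_process I D (I s @^-1` [set k]).
Proof. by move=> Ds; apply: sub_sigma_algebra; exists s => //; exists k. Qed.

Lemma sigma_processT (I : R -> Omega -> X) (D : set R) : sigma_process I D setT.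
Proof.
have sub A : sigma_process I D A -> A `<=` setT by [].
by have [] := (sigma_algebraP sub).1 (smallest_sigma_algebra _ _).
Qed.

Lemma sigma_process_measurable (I : R -> Omega -> X) (D : set R) E :
  (forall s k, D s -> measurable (I s @^-1` [set k])) ->
  sigma_process I D E -> measurable E.
Proof.
move=> mI; apply: smallest_sub; first exact: sigma_algebra_measurable.
by move=> A [s Ds [k ->]]; exact: mI.
Qed.

Variables (P : probability Omega R) (chat : X -> X -> R) (i j : X).
Variables (I J : R -> Omega -> X).
Hypothesis hI : random_walk P chat i I.
Hypothesis hJ : random_walk P chat j J.
Hypothesis hIJ : independent_processes P I J.

Definition apart (s h : R) (m : nat) : set Omega :=
  [set w | forall r, (r <= m)%N -> I (s + r%:R * h) w <> J (s + r%:R * h) w].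

Lemma measurable_differ s : 0 <= s -> measurable [set w | I s w <> J s w].
Proof.
move=> s0.
have -> : [set w | I s w <> J s w] =
    ~` \bigcup_(k in [set: X]) (I s @^-1` [set k] `&` J s @^-1` [set k]).
  apply/seteqP; split=> w /=.
    by move=> ne [k _ [/= Ik Jk]]; apply: ne; rewrite Ik Jk.
  by move=> h e; apply: h; exists (I s w).
apply: measurableC; apply: fin_bigcup_measurable => [|k _]; first exact: finite_finset.
by apply: measurableI; [exact: (rw_measurable hI) | exact: (rw_measurable hJ)].
Qed.

Lemma measurable_apart s h m : 0 <= s -> 0 <= h -> measurable (apart s h m).
Proof.
move=> s0 h0.
have -> : apart s h m =
    \bigcap_(r in [set r | (r <= m)%N]) [set w | I (s + r%:R * h) w <> J (s + r%:R * h) w].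
  by apply/seteqP; split=> w hw r /hw.
apply: bigcap_measurableType => r _.
by apply: measurable_differ; rewrite addr_ge0 // mulr_ge0.
Qed.

Lemma apartS s h m :
  apart s h m.+1 = [set w | I s w <> J s w] `&` apart (s + h) h m.
Proof.
have E (r : nat) : s + h + r%:R * h = s + r.+1%:R * h by rewrite -natr1; ring.
apply/seteqP; split=> w.
  move=> hw; split=> [|r rm]; first by have := hw 0 isT; rewrite mul0r addr0.
  by rewrite E; exact: hw.
by move=> [h0 hS] [_|r rm]; [rewrite mul0r addr0 | rewrite -E; exact: hS].
Qed.

Let pr A : R := fine (P A).

Lemma avoidanceS h m a b : avoidance chat h m.+1 (a, b) =
  (a != b)%:R * \sum_k \sum_l exp_mx (walk_generator chat) h a k
    * exp_mx (walk_generator chat) h b l * avoidance chat h m (k, l).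
Proof. by rewrite -exp_two_walk_generator. Qed.

(** [E] and [F] stand for the pasts of the two walks, so that the induction can absorb the present
    sites into them and restart one grid step later. *)
Lemma probability_apart (s h : R) m a b E F : 0 <= s -> 0 <= h ->
  sigma_process I [set u | 0 <= u <= s] E ->
  sigma_process J [set u | 0 <= u <= s] F ->
  pr ((E `&` I s @^-1` [set a]) `&` (F `&` J s @^-1` [set b]) `&` apart s h m) =
  pr (E `&` I s @^-1` [set a]) * pr (F `&` J s @^-1` [set b])
    * avoidance chat h m (a, b).
Proof.
move=> + h0.
have mI u k : 0 <= u -> measurable (I u @^-1` [set k]) by exact: (rw_measurable hI).
have mJ u k : 0 <= u -> measurable (J u @^-1` [set k]) by exact: (rw_measurable hJ).
have sub u : [set v : R | 0 <= v <= u] `<=` [set v | 0 <= v] by move=> v /= /andP[].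
elim: m s a b E F => [|m IH] s a b E F s0 sE sF.
all: have sEa : sigma_process I [set u | 0 <= u <= s] (E `&` I s @^-1` [set a])
  by apply: sigma_processI => //; apply: sigma_process_fiber; rewrite /= s0 lexx.
all: have sFb : sigma_process J [set u | 0 <= u <= s] (F `&` J s @^-1` [set b])
  by apply: sigma_processI => //; apply: sigma_process_fiber; rewrite /= s0 lexx.
all: have sEa' := sigma_process_le (sub s) sEa.
all: have sFb' := sigma_process_le (sub s) sFb.
all: have mEa := sigma_process_measurable mI sEa'.
all: have mFb := sigma_process_measurable mJ sFb'.
all: have [<-|ab] := eqVneq a b.
- rewrite /avoidance /= eqxx mulr0 /pr (_ : _ `&` _ = set0) ?measure0 //.
  apply/seteqP; split=> // w [[[_ /= Ia] [_ /= Jb]] /(_ 0 isT)].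
  by rewrite mul0r addr0 Ia Jb.
(* At the last grid time, independence of the two processes gives the product. *)
- rewrite /avoidance /= ab mulr1 -fineM ?fin_num_measure // -hIJ //.
  congr (pr _); apply/seteqP; split=> [w []//|w hw]; split=> // -[|//] _.
  by move: hw => [[_ /= Ia] [_ /= Jb]]; rewrite mul0r addr0 Ia Jb; exact/eqP.
- rewrite avoidanceS eqxx mul0r mulr0 /pr (_ : _ `&` _ = set0) ?measure0 //.
  apply/seteqP; split=> // w [[[_ /= Ia] [_ /= Jb]] /(_ 0 isT)].
  by rewrite mul0r addr0 Ia Jb.
rewrite avoidanceS ab mul1r.
have sh0 : 0 <= s + h by rewrite addr_ge0.
rewrite apartS.
set A := (X in pr X).
(* Being apart at time [s] already follows from a != b. *)
have AE : A = (E `&` I s @^-1` [set a]) `&` (F `&` J s @^-1` [set b]) `&` apart (s + h) h m.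
  apply/seteqP; split=> [w [? [? ?]] //|w [hw hA]]; split=> //; split=> //.
  by move: hw => [[_ /= Ia] [_ /= Jb]] /=; rewrite Ia Jb; exact/eqP.
have mA : measurable A.
  rewrite AE; apply: measurableI; first exact: measurableI.
  exact: measurable_apart.
rewrite /pr (total_probability P mA (fun x => mI _ x sh0)).
rewrite mulr_sumr; apply: eq_bigr => k _.
rewrite (total_probability P (measurableI _ _ mA (mI _ k sh0)) (fun x => mJ _ x sh0)).
rewrite mulr_sumr; apply: eq_bigr => l _.
have sle : [set v : R | 0 <= v <= s] `<=` [set v | 0 <= v <= s + h].
  by move=> v /= /andP[-> vs] /=; rewrite (le_trans vs) // lerDl.
(* The events at time [s] join the past, and the Markov property of each walk yields one kernel
   factor. *)
have := IH (s + h) k l _ _ sh0 (sigma_process_le sle sEa) (sigma_process_le sle sFb).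
rewrite /pr (rw_markov hI) // (rw_markov hJ) // !fineM ?fin_num_measure //=.
set x := (X in fine (P X) = _) => hx.
rewrite (_ : _ `&` _ = x) ?hx; first by ring.
by rewrite AE /x; apply/seteqP; split=> w /=; tauto.
Qed.

Lemma right_continuous_process (Y : R -> Omega -> X) w (s : R) :
  (\forall u \near s^'+, Y u w = Y s w) ->
  exists2 e : R, 0 < e & forall u, s < u -> u < s + e -> Y u w = Y s w.
Proof.
move=> /nbhs_ballP[e /= e0 he]; exists e => // u su ue.
by apply: he => //; rewrite /ball /= distrC ger0_norm ?subr_ge0 ?(ltW su) //; lra.
Qed.

Lemma dyadic_time (s t e : R) : 0 <= s -> s < t -> 0 < e ->
  exists m k, [/\ (k <= 2 ^ m)%N, s < k%:R * (t / (2 ^ m)%:R)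
                & k%:R * (t / (2 ^ m)%:R) < s + e].
Proof.
move=> s0 st e0; have t0 : 0 < t by exact: le_lt_trans st.
(* Since t / e < m + 1 <= 2^m, the mesh [h] is below [e]; the next grid point after [s] then
   works. *)
pose m := Num.truncn (t / e); pose h := t / (2 ^ m)%:R.
have p0 : 0 < (2 ^ m)%:R :> R by rewrite ltr0n expn_gt0.
have h0 : 0 < h by rewrite divr_gt0.
have he : h < e.
  rewrite ltr_pdivrMr // mulrC -ltr_pdivrMr //.
  have /truncn_itv/andP[_ tm] : 0 <= t / e by rewrite divr_ge0 // ltW.
  by apply: lt_le_trans tm _; rewrite ler_nat ltn_expl.
have /truncn_itv/andP[ks sk] : 0 <= s / h by rewrite divr_ge0 // ltW.
exists m, (Num.truncn (s / h)).+1; split.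
- rewrite -(ltr_nat R); apply: le_lt_trans ks _.
  by rewrite ltr_pdivrMr // /h mulrCA divff ?gt_eqF // mulr1.
- by rewrite -ltr_pdivrMr.
- rewrite -natr1 mulrDl mul1r ler_ltD //.
  by rewrite -ler_pdivlMr.
Qed.

(** By right-continuity, walks together at some s < t remain together up to a later dyadic point of
    the grid, so the dyadic grids detect every meeting up to [t]. *)
Lemma meeting_time_gtE (t : R) : 0 <= t ->
  [set w | (t%:E < meeting_time I J w)%E] =
  \bigcap_m apart 0 (t / (2 ^ m)%:R) (2 ^ m).
Proof.
move=> t0; apply/seteqP; split=> w /=.
  move=> tT m _ r rm IJ; move: tT; apply/negP; rewrite -leNgt.
  have p0 : 0 < (2 ^ m)%:R :> R by rewrite ltr0n expn_gt0.
  apply: (@le_trans _ _ (0 + r%:R * (t / (2 ^ m)%:R))%:E).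
    apply: ereal_inf_lbound; exists (0 + r%:R * (t / (2 ^ m)%:R)) => //; split=> //.
    by rewrite add0r mulr_ge0 // divr_ge0.
  by rewrite lee_fin add0r mulrCA ler_piMr // ler_pdivrMr // mul1r ler_nat.
move=> hw.
have apart_le s : 0 <= s -> s <= t -> I s w <> J s w.
  move=> s0; rewrite le_eqVlt => /orP[/eqP ->|st] IJ.
    (* The endpoint [t] is itself on the coarsest grid. *)
    have := hw 0%N Logic.I 1%N isT; rewrite expn0 divr1 mul1r add0r; exact.
  have [e e0 he] := right_continuous_process (rw_right_continuous hI w s0).
  have [e' e0' he'] := right_continuous_process (rw_right_continuous hJ w s0).
  have e''0 : 0 < Num.min e e' by rewrite lt_min e0.
  have [m [k [km sk]]] := dyadic_time s0 st e''0.
  rewrite -ltrBlDl lt_min => /andP[ke ke'].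
  apply: (hw m Logic.I k km); rewrite add0r he ?he' //; lra.
(* The walks are apart at [t] and keep their sites for a while, which makes the infimum strictly
   larger than [t]. *)
have [e e0 he] := right_continuous_process (rw_right_continuous hI w t0).
have [e' e0' he'] := right_continuous_process (rw_right_continuous hJ w t0).
have e''0 : 0 < Num.min e e' by rewrite lt_min e0.
apply: (@lt_le_trans _ _ (t + Num.min e e')%:E); first by rewrite lte_fin ltrDl.
apply: le_ereal_inf_tmp => _ [s [s0 IJ] <-]; rewrite lee_fin leNgt; apply/negP => st.
have [/(apart_le s s0)//|ts] := leP s t.
move: st; rewrite -ltrBlDl lt_min => /andP[se se'].
by apply: (apart_le t t0 (lexx t)); rewrite -(he s) -?(he' s) //; lra.
Qed.

(** Continuity from above of the probability along the nested dyadic grids. *)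
Lemma meeting_time_lower_bound (t a : R) : 0 <= t ->
  (forall m, a <= avoidance chat (t / (2 ^ m)%:R) (2 ^ m) (i, j)) ->
  a <= fine (P [set w | (t%:E < meeting_time I J w)%E]).
Proof.
move=> t0 ha; rewrite meeting_time_gtE //.
set B := fun m : nat => apart 0 (t / (2 ^ m)%:R) (2 ^ m).
have h0 m : 0 <= t / (2 ^ m)%:R by rewrite divr_ge0.
have mB m : measurable (B m) by exact: measurable_apart.
have mcap : measurable (\bigcap_m B m) by exact: bigcap_measurableType.
have niB : nonincreasing_seq B.
  (* Point [r] of one grid is point [2 r] of the next. *)
  apply/nonincreasing_seqP => m; apply/subsetPset => w hw r rm.
  have := hw (2 * r)%N; rewrite expnS leq_mul2l rm => /(_ isT).
  have p0 : (2 ^ m)%:R != 0 :> R by rewrite pnatr_eq0 expn_eq0.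
  suff -> : (2 * r)%:R * (t / (2 * 2 ^ m)%:R) = r%:R * (t / (2 ^ m)%:R) by [].
  by rewrite !natrM; field.
have B0 : (P (B 0%N) < +oo)%E by apply: le_lt_trans (probability_le1 P (mB 0%N)) (ltry 1).
have cvgB := nonincreasing_cvg_mu B0 mB mcap niB.
rewrite -lee_fin EFin_fine_probability // -(cvg_lim _ cvgB) //.
apply: lime_ge; first by apply/cvg_ex; exists (P (\bigcap_m B m)).
apply: nearW => m /=; rewrite -(EFin_fine_probability P (mB m)) lee_fin.
apply: le_trans (ha m) _.
have mI0 : measurable (setT `&` I 0 @^-1` [set i]).
  by rewrite setTI; exact: (rw_measurable hI).
have mJ0 : measurable (setT `&` J 0 @^-1` [set j]).
  by rewrite setTI; exact: (rw_measurable hJ).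
have := @probability_apart 0 (t / (2 ^ m)%:R) (2 ^ m) i j setT setT (lexx _) (h0 m)
  (@sigma_processT I _) (@sigma_processT J _).
have -> : pr (setT `&` I 0 @^-1` [set i]) = 1 by rewrite /pr setTI (rw_start hI).
have -> : pr (setT `&` J 0 @^-1` [set j]) = 1 by rewrite /pr setTI (rw_start hJ).
have mA := measurableI _ _ (measurableI _ _ mI0 mJ0) (mB m).
rewrite !mul1r => <-; rewrite -lee_fin /pr !EFin_fine_probability //.
by apply: le_measure; rewrite ?inE //; exact: subIsetr.
Qed.

End MeetingTime.

(** * The semigroup of random transpositions *)

Section TranspositionSemigroup.
Context {R : realType} {n : nat}.
Implicit Types (f g : 'S_n -> R) (p : 'I_n * 'I_n).

(** The sum runs over ordered pairs: each transposition has rate 2 and the diagonal contributes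
    zero. *)
Definition transposition_generator f x : R := \sum_p (f (transpose p x) - f x).

Local Notation M := transposition_generator.
Local Notation Q := (exp_gen transposition_generator).

Lemma lin_op_transposition_generator : lin_op M.
Proof.
have [l hl] := lin_op_sum (index_enum ('I_n * 'I_n)%type) (fun _ (_ : 'S_n) => true)
  (fun p => lin_opB (lin_op_eval (R := R) (transpose p)) (lin_op_eval id)).
by exists l => f x; rewrite -hl.
Qed.

(** Conjugation by [s] permutes the pairs; hence this generator commutes with every shuffle. *)
Lemma transposition_generator_mul s f x :
  M f (s * x)%g = M (fun y => f (s * y)%g) x.
Proof.
have bij : injective (shuffle_pair (s^-1)%g).
  by move=> [i j] [i' j'] [] /perm_inj -> /perm_inj ->.
rewrite /M (reindex_inj bij) /=; apply: eq_bigr => p _.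
by rewrite transpose_mul.
Qed.

Lemma transposition_shuffle_commute c f y :
  shuffle_generator c (M f) y = M (shuffle_generator c f) y.
Proof.
have [m hm] := lin_op_transposition_generator.
rewrite [RHS]hm shuffle_generatorE.
under [RHS]eq_bigr do rewrite shuffle_generatorE mulr_sumr.
rewrite exchange_big /=; apply: eq_bigr => A _.
under [RHS]eq_bigr do rewrite mulrCA mulrBr.
rewrite -mulr_sumr sumrB -(hm f); congr (_ * (_ - _)).
under [RHS]eq_bigr do rewrite -block_meanZ.
rewrite -block_mean_sum; apply: eq_block_mean => s _.
by rewrite transposition_generator_mul hm.
Qed.

Lemma transposition_generator_sym f g : \sum_x g x * M f x = \sum_x M g x * f x.
Proof.
under eq_bigr do rewrite mulr_sumr.
under [RHS]eq_bigr do rewrite mulr_suml.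
rewrite exchange_big [RHS]exchange_big; apply: eq_bigr => p _ /=.
under eq_bigr do rewrite mulrBr.
under [RHS]eq_bigr do rewrite mulrBl.
rewrite !sumrB; congr (_ - _).
rewrite [RHS](reindex_inj (inv_inj (transposeK p))) /=.
by apply: eq_bigr => x _; rewrite transposeK.
Qed.

Lemma transposition_generator_pos f : (forall x, 0 <= f x) ->
  forall x, 0 <= M f x + (\sum_(p : 'I_n * 'I_n) 1) * f x.
Proof.
move=> f0 x; rewrite mulr_suml -big_split; apply: sumr_ge0 => p _ /=.
by rewrite mul1r subrK.
Qed.

Lemma transposition_generator_cst a x : M (fun=> a) x = 0.
Proof. by apply: big1 => p _; rewrite subrr. Qed.

Lemma transposition_semigroup_gt0 f s : 0 <= s -> (forall x, 0 < f x) ->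
  forall x, 0 < Q s f x.
Proof.
apply: exp_gen_gt0; first exact: lin_op_transposition_generator.
  exact: transposition_generator_pos.
by move=> x; exact: transposition_generator_cst.
Qed.

Lemma sum_exp_gen_sym (L : ('S_n -> R) -> 'S_n -> R) f s : lin_op L ->
  (forall x, L (fun=> 1) x = 0) ->
  (forall f g, \sum_x g x * L f x = \sum_x L g x * f x) ->
  \sum_x exp_gen L s f x = \sum_x f x.
Proof.
move=> hL L1 sym.
have := exp_gen_adjoint s f (fun=> 1) hL sym.
under eq_bigr do rewrite mul1r.
by move=> ->; apply: eq_bigr => x _; rewrite exp_gen_fixed // mul1r.
Qed.

Lemma sum_transposition_semigroup f s : \sum_x Q s f x = \sum_x f x.
Proof.
apply: sum_exp_gen_sym; first exact: lin_op_transposition_generator.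
  by move=> x; exact: transposition_generator_cst.
exact: transposition_generator_sym.
Qed.

Lemma transposition_generator_ln f :
  \sum_x M f x * ln (f x) = - (\sum_p transposition_energy f p) / 2.
Proof.
rewrite -sumrN mulr_suml; under eq_bigr do rewrite mulr_suml.
rewrite exchange_big /=; apply: eq_bigr => p _.
set T := LHS.
(* Reindexing by the involution and averaging the two forms of [T] produces the factor 1/2. *)
have T2 : T = \sum_x (f x - f (transpose p x)) * ln (f (transpose p x)).
  rewrite /T (reindex_inj (inv_inj (transposeK p))) /=.
  by apply: eq_bigr => x _; rewrite transposeK.
have -> : transposition_energy f p = - (T + T).
  rewrite {2}T2 -big_split -sumrN; apply: eq_bigr => x _ /=; ring.
by field.
Qed.

Lemma transposition_generator_sqr f :
  \sum_x M f x * f x = - (\sum_p \sum_x (f (transpose p x) - f x) ^+ 2) / 2.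
Proof.
rewrite -sumrN mulr_suml; under eq_bigr do rewrite mulr_suml.
rewrite exchange_big /=; apply: eq_bigr => p _.
set T := LHS.
have T2 : T = \sum_x (f x - f (transpose p x)) * f (transpose p x).
  rewrite /T (reindex_inj (inv_inj (transposeK p))) /=.
  by apply: eq_bigr => x _; rewrite transposeK.
have -> : \sum_x (f (transpose p x) - f x) ^+ 2 = - (T + T).
  rewrite {2}T2 -big_split -sumrN; apply: eq_bigr => x _ /=; ring.
by field.
Qed.

(** Write [s] as a product of transpositions and peel them off with (u + v)^2 <= 2 u^2 + 2 v^2. *)
Lemma increment_le_transpositions (s : 'S_n) : exists2 K : R, 0 <= K &
  forall f, \sum_x (f (s * x)%g - f x) ^+ 2 <=
            K * \sum_p \sum_x (f (transpose p x) - f x) ^+ 2.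
Proof.
have [ts -> _] := prod_tpermP s; elim: ts => [|p ts [K K0 hK]].
  exists 0 => // f; rewrite mul0r big_nil big1 // => x _.
  by rewrite mul1g subrr expr0n.
exists (2 + 2 * K) => [|f]; first by rewrite addr_ge0 // mulr_ge0.
rewrite big_cons; set u := (\prod_(t <- ts) _)%g.
apply: (@le_trans _ _ (2 * \sum_x (f (transpose p (u * x)%g) - f (u * x)%g) ^+ 2
    + 2 * \sum_x (f (u * x)%g - f x) ^+ 2)).
  rewrite !mulr_sumr -big_split; apply: ler_sum => x _ /=.
  rewrite /transpose mulgA.
  have := sqr_ge0 (f (tperm p.1 p.2 * u * x)%g - f (u * x)%g - (f (u * x)%g - f x)).
  lra.
rewrite [leRHS]mulrDl; apply: lerD; last by rewrite -mulrA ler_wpM2l.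
rewrite ler_wpM2l // -(reindex_inj (mulgI u) (P := xpredT)
  (F := fun x => (f (transpose p x) - f x) ^+ 2)).
rewrite [leRHS](bigD1 p) //= lerDl; apply: sumr_ge0 => q _.
by apply: sumr_ge0 => x _; exact: sqr_ge0.
Qed.

Lemma sum_cst (a : R) : \sum_(x : 'S_n) a = #|'S_n|%:R * a.
Proof. by rewrite sumr_const mulr_natl. Qed.

(** Summing the increments over all [s] compares every pair of permutations, which gives twice the
    left-hand side. *)
Lemma poincare : exists2 K : R, 0 < K & forall f,
  #|'S_n|%:R * \sum_x f x ^+ 2 - (\sum_x f x) ^+ 2 <=
  K * \sum_p \sum_x (f (transpose p x) - f x) ^+ 2.
Proof.
have hex (s : 'S_n) : exists k : R, 0 <= k /\
    forall f, \sum_x (f (s * x)%g - f x) ^+ 2 <=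
            k * \sum_p \sum_x (f (transpose p x) - f x) ^+ 2.
  by have [k k0 hk] := increment_le_transpositions s; exists k.
have [K hK] := boolp.choice hex.
have K0 : 0 <= \sum_s K s by apply: sumr_ge0 => s _; have [] := hK s.
(* The extra 1 makes the constant positive, so that it can be divided by later. *)
exists (1 + \sum_s K s) => [|f]; first by lra.
set E := \sum_p _.
have E0 : 0 <= E.
  by apply: sumr_ge0 => q _; apply: sumr_ge0 => x _; exact: sqr_ge0.
have : \sum_s \sum_x (f (s * x)%g - f x) ^+ 2 <= (\sum_s K s) * E.
  by rewrite mulr_suml; apply: ler_sum => s _; have [_] := hK s; exact.
have -> : \sum_s \sum_x (f (s * x)%g - f x) ^+ 2 =
    2 * (#|'S_n|%:R * \sum_x f x ^+ 2 - (\sum_x f x) ^+ 2).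
  rewrite exchange_big /=.
  transitivity (\sum_x \sum_y (f y - f x) ^+ 2).
    apply: eq_bigr => x _; rewrite [RHS](reindex_inj (mulIg x)) /=.
    by apply: eq_bigr.
  transitivity (\sum_x ((\sum_y f y ^+ 2) - 2 * f x * (\sum_y f y) + #|'S_n|%:R * f x ^+ 2)).
    apply: eq_bigr => x _.
    rewrite mulr_sumr -sum_cst -sumrB -big_split.
    by apply: eq_bigr => y _ /=; ring.
  rewrite big_split sumrB /= sum_cst -mulr_suml -!mulr_sumr.
  by rewrite expr2; ring.
by nra.
Qed.

End TranspositionSemigroup.

(** * Relative entropy *)

Section Entropy.
Context {R : realType} {n : nat}.
Implicit Types (f g mu : 'S_n -> R) (s t : R).

Local Notation M := (@transposition_generator R n).
Local Notation Q := (exp_gen (@transposition_generator R n)).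
Local Notation N := (#|'S_n|%:R : R).
Local Notation H mu := (rel_entropy mu (@uniform_law R 'S_n)).

Lemma ln_tangent (a b : R) : 0 <= a -> 0 < b -> a - b <= a * (ln a - ln b).
Proof.
move=> a0 b0; have [->|an] := eqVneq a 0; first by rewrite mul0r; lra.
have {an}a0 : 0 < a by rewrite lt_def an.
have := @ln_leB1 R (b / a) (divr_gt0 b0 a0); rewrite ln_div ?posrE // => h.
have := ler_wpM2l (ltW a0) h.
have -> : a * (b / a - 1) = b - a by field; rewrite gt_eqF.
lra.
Qed.

Lemma card_Sn_gt0 : 0 < N.
Proof. by rewrite ltr0n; apply/card_gt0P; exists 1%g. Qed.

Lemma rel_entropyE mu : H mu = \sum_x mu x * ln (mu x * N).
Proof. by apply: eq_bigr => x _; rewrite /uniform_law invrK. Qed.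

Lemma rel_entropy_pos mu : (forall x, 0 < mu x) ->
  H mu = \sum_x mu x * ln (mu x) + (\sum_x mu x) * ln N.
Proof.
move=> mu0; rewrite rel_entropyE mulr_suml -big_split; apply: eq_bigr => x _ /=.
by rewrite lnM ?posrE ?card_Sn_gt0 // mulrDr.
Qed.

Lemma rel_entropy_ge0 mu : is_law mu -> 0 <= H mu.
Proof.
case=> mu0 mu1; have N0 := card_Sn_gt0.
have := ler_sum (P := xpredT) (index_enum 'S_n) (fun x _ =>
  ln_tangent (mulr_ge0 (mu0 x) (ltW N0)) ltr01).
rewrite sumrB -mulr_suml mu1 mul1r sum_cst mulr1 subrr => h.
rewrite -(pmulr_rge0 _ N0); apply: le_trans h _.
rewrite rel_entropyE mulr_sumr; apply: ler_sum => x _.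
by rewrite ln1 subr0 mulrA [N * _]mulrC.
Qed.

Lemma rel_entropy_le_variance mu : is_law mu -> (forall x, 0 < mu x) ->
  H mu <= N * \sum_x mu x ^+ 2 - 1.
Proof.
case=> _ mu1 mu0; have N0 := card_Sn_gt0.
rewrite rel_entropyE -[X in _ - X]mu1 mulr_sumr -sumrB; apply: ler_sum => x _.
have -> : N * mu x ^+ 2 - mu x = mu x * (mu x * N - 1) by ring.
by rewrite ler_pM2l //; apply: ln_leB1; rewrite mulr_gt0.
Qed.

(** Poincare inequality and Gronwall: the derivative of [v] is at most [- lam * v]. *)
Lemma variance_decay g : \sum_x g x = 1 -> exists2 lam : R, 0 < lam &
  forall s, 0 <= s ->
    expR (lam * s) * (N * \sum_x Q s g x ^+ 2 - 1) <= N * \sum_x g x ^+ 2 - 1.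
Proof.
move=> g1; have [K K0 hK] := @poincare R n; have N0 := card_Sn_gt0.
have hM := @lin_op_transposition_generator R n.
exists (N / K); first by rewrite divr_gt0.
set lam := N / K => s s0.
pose v s : R := N * \sum_x Q s g x ^+ 2 - 1.
pose dv s : R := N * \sum_x 2 * (M (Q s g) x * Q s g x).
have hv (u : R) : is_derive u 1 v (dv u).
  have hq x : is_derive u 1 (fun r => Q r g x * Q r g x) (2 * (M (Q u g) x * Q u g x)).
    have := is_derive1M (is_derive_exp_gen hM g x u) (is_derive_exp_gen hM g x u).
    by rewrite exp_gen_generator // [X in _ + X]mulrC -mulr2n mulr_natl.
  have h1 : is_derive u 1 (fun _ : R => -1 : R) 0 by exact: is_derive_cst.
  have := is_derive1D (is_derive1Zl N (is_derive1_sum (index_enum 'S_n)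
    (P := xpredT) (fun x _ => hq x))) h1.
  by rewrite addr0.
have hE (u : R) : is_derive u 1 (fun r => expR (lam * r)) (expR (lam * u) * lam).
  have := is_derive1_affine (x := u) (a := 0) (b := lam) (is_derive_expR (0 + lam * u)).
  by under [X in is_derive _ _ X]funext do rewrite add0r; rewrite add0r.
have := @is_derive1_le0 R (fun r => expR (lam * r) * v r)
  (fun u => expR (lam * u) * lam * v u + expR (lam * u) * dv u) 0 _ _ s s0.
rewrite mulr0 expR0 mul1r /v.
under [X in _ -> _ -> _ <= N * X - 1]eq_bigr do rewrite exp_gen0 //.
apply=> [u _|u _]; first exact: is_derive1M.
rewrite -mulrA -mulrDr mulr_ge0_le0 ?expR_ge0 // /dv -mulr_sumr.
rewrite transposition_generator_sqr.
have := hK (Q u g); rewrite sum_transposition_semigroup g1 expr1n.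
set E := \sum_p _; rewrite -/(v u) => /(ler_wpM2l (ltW (divr_gt0 N0 K0))).
have -> : N / K * (K * E) = N * E by field; rewrite gt_eqF.
rewrite -/lam -/(v u); lra.
Qed.

(** The derivative of y ln y is ln y + 1, and the contribution of the 1 vanishes because total mass
    is conserved. *)
Lemma is_derive_entropy f s : 0 <= s -> (forall x, 0 < f x) ->
  is_derive s 1 (fun r => \sum_x Q r f x * ln (Q r f x))
    (- (\sum_p transposition_energy (Q s f) p) / 2).
Proof.
move=> s0 f0; have hM := @lin_op_transposition_generator R n.
have q0 x : 0 < Q s f x by exact: transposition_semigroup_gt0.
have hx x : is_derive s 1 (fun r => Q r f x * ln (Q r f x))
    (M (Q s f) x * ln (Q s f x) + M (Q s f) x).
  have hq := is_derive_exp_gen hM f x s.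
  have hl := @is_derive1_comp _ (@ln R) (fun r => Q r f x) s _ _
    (is_derive1_ln (q0 x)) hq.
  have := is_derive1M hq hl; rewrite exp_gen_generator //.
  by rewrite mulrA divff ?gt_eqF // mul1r.
have := is_derive1_sum (index_enum 'S_n) (P := xpredT) (fun x _ => hx x).
rewrite big_split /= transposition_generator_ln.
suff -> : \sum_x M (Q s f) x = 0 by rewrite addr0.
under eq_bigr do rewrite -[M _ _]mul1r.
rewrite transposition_generator_sym big1 // => x _.
by rewrite transposition_generator_cst mul0r.
Qed.

Variable c : {set 'I_n} -> R.
Hypothesis hc : forall A, 0 <= c A.
Local Notation P t := (exp_gen (shuffle_generator c) t).

Lemma shuffle_semigroup_gt0 t f : 0 <= t -> (forall x, 0 < f x) -> forall x, 0 < P t f x.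
Proof.
apply: (@exp_gen_gt0 _ _ _ (\sum_A c A)); first exact: lin_op_shuffle.
  by move=> h h0; exact: shuffle_generator_pos.
by move=> x; exact: shuffle_generator_cst.
Qed.

Lemma shuffle_semigroup_ge0 t f : 0 <= t -> (forall x, 0 <= f x) -> forall x, 0 <= P t f x.
Proof.
move=> t0 f0 x; rewrite -(@exp_gen_fixed _ _ (shuffle_generator c) t (fun=> 0) x).
- apply: (@exp_gen_le _ _ _ (\sum_A c A)) => //; first exact: lin_op_shuffle.
  by move=> h h0; exact: shuffle_generator_pos.
- exact: lin_op_shuffle.
- by move=> z; exact: shuffle_generator_cst.
Qed.

Lemma sum_shuffle_semigroup t f : \sum_x P t f x = \sum_x f x.
Proof.
apply: sum_exp_gen_sym; first exact: lin_op_shuffle.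
  by move=> x; exact: shuffle_generator_cst.
by move=> g h; exact: shuffle_generator_sym.
Qed.

(* The semigroup Q of random transpositions commutes with P t, and its entropy
   production only involves pairs of permutations that differ by a
   transposition. The inequality integrates
   sum_p transposition_energy (P t (Q s f)) p
   <= a * sum_p transposition_energy (Q s f) p over s >= 0. *)
Lemma rel_entropy_contract_gt0 t a f : 0 <= t -> 0 <= a ->
  (forall i j, i != j -> pair_survival c t (i, j) <= a) ->
  is_law f -> (forall x, 0 < f x) -> H (P t f) <= a * H f.
Proof.
move=> t0 a0 ha hf f0; have f1 := hf.2; set g := P t f.
have g0 : forall x, 0 < g x by exact: shuffle_semigroup_gt0.
have g1 : \sum_x g x = 1 by rewrite sum_shuffle_semigroup.
have hM := @lin_op_transposition_generator R n.
pose S f s : R := \sum_x Q s f x * ln (Q s f x).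
have HS h s : 0 <= s -> (forall x, 0 < h x) -> \sum_x h x = 1 ->
    H (Q s h) = S h s + ln N.
  move=> s0 h0 h1; rewrite rel_entropy_pos; last exact: transposition_semigroup_gt0.
  by rewrite sum_transposition_semigroup h1 mul1r.
have lawQ h s : 0 <= s -> (forall x, 0 < h x) -> \sum_x h x = 1 -> is_law (Q s h).
  move=> s0 h0 h1; split; last by rewrite sum_transposition_semigroup.
  by move=> x; apply/ltW/transposition_semigroup_gt0.
have Q0 h : Q 0 h = h by apply/funext => x; rewrite exp_gen0.
have mono s : 0 <= s -> a * S f s + (-1) * S g s <= a * S f 0 + (-1) * S g 0.
  pose dS h u : R := - (\sum_p transposition_energy (Q u h) p) / 2.
  move=> s0; apply: (@is_derive1_le0 R (fun u => a * S f u + (-1) * S g u)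
    (fun u => a * dS f u + (-1) * dS g u)) => // u u0.
    by apply: is_derive1D; apply: is_derive1Zl; exact: is_derive_entropy.
  have QP : Q u g = P t (Q u f).
    apply/funext => x; rewrite /g exp_gen_commute2 //; first exact: lin_op_shuffle.
    by move=> h y; rewrite transposition_shuffle_commute.
  rewrite /dS QP; have := sum_transposition_energy_contract hc t0
    (transposition_semigroup_gt0 u0 f0) ha.
  lra.
have [lam lam0 hlam] := variance_decay g1.
set V := N * \sum_x g x ^+ 2 - 1 in hlam.
(* A positive defect [D] would remain a lower bound for the entropy of [Q s g] at all times,
   although that entropy is below a variance that decays exponentially. *)
rewrite leNgt; apply/negP => hlt; pose D := H g - a * H f.
have D0 : 0 < D by rewrite /D subr_gt0.
have HD s : 0 <= s -> D <= H (Q s g).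
  move=> s0; have := mono s s0.
  have := mulr_ge0 a0 (rel_entropy_ge0 (lawQ f s s0 f0 f1)).
  have -> : D = (S g 0 + ln N) - a * (S f 0 + ln N) by rewrite /D -!HS // !Q0.
  rewrite !HS //; lra.
have bound s : 0 <= s -> (1 + lam * s) * D <= V.
  move=> s0; apply: le_trans (hlam s s0).
  apply: ler_pM; [by rewrite addr_ge0 // mulr_ge0 // ltW | exact: ltW | exact: expR_ge1Dx |].
  apply: le_trans (HD s s0) _.
  apply: rel_entropy_le_variance; first exact: lawQ.
  exact: transposition_semigroup_gt0.
have V0 : 0 < V.
  by have := bound 0 (lexx _); rewrite mulr0 addr0 mul1r; exact: lt_le_trans.
(* At this time [bound] reads D + V <= V. *)
have s0 : 0 <= V / (D * lam) by rewrite ltW // divr_gt0 // mulr_gt0.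
have := bound _ s0.
have -> : (1 + lam * (V / (D * lam))) * D = D + V by field; rewrite !gt_eqF.
lra.
Qed.

(* y ln y is convex and vanishes at 1. *)
Lemma rel_entropy_mix_le mu (e : R) : is_law mu -> 0 < e < 1 ->
  H (fun x => (1 - e) * mu x + e / N) <= (1 - e) * H mu.
Proof.
move=> [mu0 mu1] /andP[e0 e1]; have N0 := card_Sn_gt0.
rewrite !rel_entropyE mulr_sumr; apply: ler_sum => x _.
set y := mu x * N; have y0 : 0 <= y by rewrite mulr_ge0 // ltW.
have -> : ((1 - e) * mu x + e / N) * N = (1 - e) * y + e.
  by rewrite /y; field; rewrite gt_eqF.
set z := (1 - e) * y + e.
have z0 : 0 < z by rewrite ltr_wpDl // mulr_ge0 // subr_ge0 ltW.
have e1' : 0 <= 1 - e by rewrite subr_ge0 ltW.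
have h1 := ler_wpM2l e1' (ln_tangent y0 z0).
have h2 := ler_wpM2l (ltW e0) (ln_tangent ler01 z0); rewrite ln1 in h2.
suff : ((1 - e) * mu x + e / N) * ln z * N <= (1 - e) * (mu x * ln y) * N.
  by rewrite ler_pM2r.
have -> : ((1 - e) * mu x + e / N) * ln z * N = z * ln z.
  by rewrite /z /y; field; rewrite gt_eqF.
have -> : (1 - e) * (mu x * ln y) * N = (1 - e) * (y * ln y) by rewrite /y; ring.
have {h1 h2} : (1 - e) * (y - z) + e * (1 - z) <=
    (1 - e) * (y * ln y) - ((1 - e) * y + e) * ln z by lra.
have -> : (1 - e) * (y - z) + e * (1 - z) = 0 by rewrite /z; ring.
by rewrite subr_ge0.
Qed.

(* y ln y is superadditive. *)
Lemma rel_entropy_mix_ge mu (e : R) : is_law mu -> 0 < e < 1 ->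
  (1 - e) * H mu + (1 - e) * ln (1 - e) + e * ln e <=
  H (fun x => (1 - e) * mu x + e / N).
Proof.
move=> [mu0 mu1] /andP[e0 e1]; have N0 := card_Sn_gt0.
have -> : (1 - e) * H mu + (1 - e) * ln (1 - e) + e * ln e =
    \sum_x ((1 - e) * (mu x * ln (mu x * N)) + mu x * ((1 - e) * ln (1 - e))
             + e * ln e / N).
  rewrite !big_split /= sum_cst -mulr_suml mu1 mul1r -mulr_sumr -rel_entropyE.
  by rewrite mulrCA divff ?gt_eqF // mulr1.
rewrite [leRHS]rel_entropyE; apply: ler_sum => x _.
set y := mu x * N; have y0 : 0 <= y by rewrite mulr_ge0 // ltW.
have -> : ((1 - e) * mu x + e / N) * N = (1 - e) * y + e.
  by rewrite /y; field; rewrite gt_eqF.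
set z := (1 - e) * y + e.
have e1' : 0 < 1 - e by rewrite subr_gt0.
have ey0 : 0 <= (1 - e) * y by rewrite mulr_ge0 // ltW.
have z0 : 0 < z by rewrite ltr_wpDl.
have hz : e * ln e <= e * ln z.
  by rewrite ler_pM2l // ler_ln ?posrE // lerDr.
have hy : (1 - e) * y * (ln (1 - e) + ln y) <= (1 - e) * y * ln z.
  have [->|yn] := eqVneq y 0; first by rewrite mulr0 !mul0r.
  have {yn}y0' : 0 < y by rewrite lt_def yn.
  have yz : (1 - e) * y <= z by rewrite lerDl ltW.
  have ep : 0 < (1 - e) * y by rewrite mulr_gt0.
  by rewrite -lnM ?posrE // ler_wpM2l // ler_ln ?posrE.
suff : ((1 - e) * (mu x * ln y) + mu x * ((1 - e) * ln (1 - e)) + e * ln e / N) * N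
    <= ((1 - e) * mu x + e / N) * ln z * N by rewrite ler_pM2r.
have -> : ((1 - e) * mu x + e / N) * ln z * N = (1 - e) * y * ln z + e * ln z.
  by rewrite /y; field; rewrite gt_eqF.
have -> : ((1 - e) * (mu x * ln y) + mu x * ((1 - e) * ln (1 - e)) + e * ln e / N) * N
    = (1 - e) * y * (ln (1 - e) + ln y) + e * ln e.
  by rewrite /y; field; rewrite gt_eqF.
exact: lerD.
Qed.

(** With mixing weight e = r^2, e ln e equals 2 r (r ln r), and r ln r >= r - 1 gives an explicit
    bound linear in [r]. *)
Lemma entropy_defect_bound (r : R) : 0 < r < 1 ->
  - (3 * r) <= (1 - r ^+ 2) * ln (1 - r ^+ 2) + r ^+ 2 * ln (r ^+ 2).
Proof.
move=> /andP[r0 r1]; have r2 : 0 < r ^+ 2 by rewrite exprn_gt0.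
have r21 : r ^+ 2 < r by rewrite expr2 -[ltRHS]mulr1 ltr_pM2l.
have h1 : 1 - r ^+ 2 - 1 <= (1 - r ^+ 2) * ln (1 - r ^+ 2).
  have := @ln_tangent (1 - r ^+ 2) 1; rewrite ln1 subr0; apply=> //; lra.
have h2 : r * (r - 1) <= r * (r * ln r).
  rewrite ler_pM2l //; have := ln_tangent (ltW r0) ltr01; rewrite ln1 subr0; exact.
have E1 : r ^+ 2 * (ln r *+ 2) = 2 * (r * (r * ln r)) by rewrite -mulr_natr; ring.
have E2 : r * (r - 1) = r ^+ 2 - r by ring.
rewrite lnXn // E1; rewrite E2 in h2; lra.
Qed.

(** Mix [mu] with the uniform law, which the semigroup fixes, to reach positive laws; the error is
    at most [3 * r] and a small [r] concludes. *)
Lemma rel_entropy_contract t a mu : 0 <= t -> 0 <= a ->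
  (forall i j, i != j -> pair_survival c t (i, j) <= a) ->
  is_law mu -> H (P t mu) <= a * H mu.
Proof.
move=> t0 a0 ha [mu0 mu1]; have N0 := card_Sn_gt0.
rewrite leNgt; apply/negP => hlt; pose D := H (P t mu) - a * H mu.
have D0 : 0 < D by rewrite /D subr_gt0.
have hP : is_law (P t mu).
  by split; [exact: shuffle_semigroup_ge0 | rewrite sum_shuffle_semigroup].
have bound r : 0 < r < 1 -> (1 - r ^+ 2) * D <= 3 * r.
  move=> r01; have /andP[r0 r1] := r01.
  have r2 : 0 < r ^+ 2 < 1.
    by rewrite exprn_gt0 // expr_lt1 // ltW.
  have /andP[e0 e1] := r2; set e := r ^+ 2 in r2 e0 e1 *.
  pose f x := (1 - e) * mu x + e / N.
  have f0 x : 0 < f x.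
    by rewrite ltr_wpDl ?divr_gt0 // mulr_ge0 // subr_ge0 ltW.
  have hf : is_law f.
    split=> [x|]; first exact: ltW.
    rewrite big_split /= sum_cst -mulr_sumr mu1 mulrCA divff ?gt_eqF //.
    by rewrite !mulr1 subrK.
  have Pf : P t f = fun x => (1 - e) * P t mu x + e / N.
    apply/funext => x; rewrite lin_op_linear; last first.
      by apply: lin_op_exp_gen; exact: lin_op_shuffle.
    congr (_ + _); apply: exp_gen_fixed; first exact: lin_op_shuffle.
    by move=> z; exact: shuffle_generator_cst.
  have h1 := rel_entropy_contract_gt0 t0 a0 ha hf f0.
  have h2 := ler_wpM2l a0 (rel_entropy_mix_le (conj mu0 mu1) r2).
  have h3 := rel_entropy_mix_ge hP r2.
  have h4 := entropy_defect_bound r01; rewrite -/e in h4.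
  rewrite Pf in h1; rewrite /D mulrBr mulrCA; rewrite -/f in h2; lra.
(* Then [bound] would give (3/4) D <= (3/8) D. *)
pose r := Num.min (2^-1) (D / 8).
have r0 : 0 < r by rewrite lt_min invr_gt0 ltr0n divr_gt0.
have rh : r <= 2^-1 by rewrite ge_min lexx.
have rD : r <= D / 8 by rewrite ge_min lexx orbT.
have := bound r; rewrite r0 /= => /(_ ltac:(lra)).
have : r ^+ 2 <= 4^-1.
  by have := ler_pM (ltW r0) (ltW r0) rh rh; rewrite -expr2; lra.
nra.
Qed.

(** The generator is symmetric, so acting on laws and acting on functions coincide. *)
Lemma law_mul_exp_mx mu t y : law_mul mu (exp_mx (shuffle_generator c) t) y = P t mu y.
Proof.
have := exp_gen_adjoint t (fun z => (z == y)%:R) mu (lin_op_shuffle c)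
  (@shuffle_generator_sym R n c).
rewrite /law_mul /exp_mx => ->.
rewrite (bigD1 y) //= eqxx mulr1 big1 ?addr0 // => x /negbTE ->.
by rewrite mulr0.
Qed.

End Entropy.

Theorem corollary4 (R : realType) (n : nat) (hn : (1 <= n)%N)
  (c : {set 'I_n} -> R) (hc : forall A, 0 <= c A)
  (d : measure_display) (Omega : measurableType d)
  (P : 'I_n -> 'I_n -> probability Omega R) (I J : R -> Omega -> 'I_n)
  (hI : forall i j, random_walk (P i j) (conductance c) i I)
  (hJ : forall i j, random_walk (P i j) (conductance c) j J)
  (hIJ : forall i j, independent_processes (P i j) I J)
  (mu : 'S_n -> R) (hmu : is_law mu) (t : R) (ht : 0 <= t) :
  rel_entropy (law_mul mu (exp_mx (shuffle_generator c) t)) uniform_law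
  <= rel_entropy mu uniform_law
     * \big[Num.max/0]_(i < n) \big[Num.max/0]_(j < n)
         fine (P i j [set w | (t%:E < meeting_time I J w)%E]).
Proof.
have -> : law_mul mu (exp_mx (shuffle_generator c) t) = exp_gen (shuffle_generator c) t mu.
  by apply/funext => y; exact: law_mul_exp_mx.
(* Here [a] is the maximum, nonnegative thanks to its default value 0. *)
rewrite mulrC; apply: rel_entropy_contract => //.
  exact: Order.TotalTheory.bigmax_ge_id.
move=> i j ij.
apply: (@le_trans _ _ (fine (P i j [set w | (t%:E < meeting_time I J w)%E]))).
  apply: (meeting_time_lower_bound (hI i j) (hJ i j) (hIJ i j) ht) => m.
  have p0 : (2 ^ m)%:R != 0 :> R by rewrite pnatr_eq0 expn_eq0.
  (* Write [t] as 2^m steps of length t / 2^m. *)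
  rewrite -[t in pair_survival c t](mulfVK p0) [t / _ * _]mulrC.
  by apply: pair_survival_le_avoidance => //; rewrite divr_ge0.
by apply: (Order.TotalTheory.bigmax_sup i) => //; exact: (Order.TotalTheory.bigmax_sup j).
Qed.
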